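(* Let $\alpha>1/2$, $d\in\mathbb{N}$, let $\boldsymbol{\gamma}=(\gamma_u)_{u\subset\mathbb{N},|u|<\infty}$ be a collection of non-negative weights with $\gamma_\emptyset=1$, let $M\ge 1$, and let $\mathcal{A}_d=\mathcal{A}_{d,\alpha,\boldsymbol{\gamma}}(M)=\{\boldsymbol{k}\in\mathbb{Z}^d \mid r_{\alpha,\boldsymbol{\gamma}}(\boldsymbol{k})\le M\}$. Let $c\in(1,\infty)$ and $\delta\in(0,1)$ be such that $|\mathcal{A}_d|\ge 2$ and $\eta:=c(|\mathcal{A}_d|-1)\ge \max(N_{\mathcal{A}_d},\,4L_{\max}\log L_{\max})$. Consider the randomized (randomly shifted) multiple rank-1 lattice-based algorithm $A_{N,\boldsymbol{\Delta}}^{\mathrm{mult}}$ in which the number of lattices $L$ and the lattice parameters $(n_t,\boldsymbol{g}_t)$, $t=1,\ldots,L$, are the output of the random construction (Algorithm LC, described in the context) with input $\mathcal{A}_d,c,\delta$. Then, with probability at least $1-\delta$ (with respect to the random construction of the lattices), $$\mathrm{err}_2^{\mathrm{rand}}(A_{N,\boldsymbol{\Delta}}^{\mathrm{mult}},H_{d,\alpha,\boldsymbol{\gamma}})\le\frac{\sqrt{L+1}}{M}.$$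
   Context: **Weighted Korobov space.** For $\boldsymbol{k}\in\mathbb{Z}^d$ let $u=\mathrm{supp}(\boldsymbol{k})=\{j\in\{1,\ldots,d\}\mid k_j\ne0\}$ and $r_{\alpha,\boldsymbol{\gamma}}(\boldsymbol{k})=\frac{1}{\gamma_u}\prod_{j\in u}|k_j|^\alpha$ (empty product $=1$; if $\gamma_u=0$, then $r_{\alpha,\boldsymbol{\gamma}}(\boldsymbol{k})=+\infty$ and $\widehat f(\boldsymbol{k})=0$ is required). $H_{d,\alpha,\boldsymbol{\gamma}}$ is the space of continuous functions $f$ on $[0,1]^d$, 1-periodic in each variable, with finite norm $\|f\|_{d,\alpha,\boldsymbol{\gamma}}=\big(\sum_{\boldsymbol{k}\in\mathbb{Z}^d}r_{\alpha,\boldsymbol{\gamma}}^2(\boldsymbol{k})|\widehat f(\boldsymbol{k})|^2\big)^{1/2}$, where $\widehat f(\boldsymbol{k})=\int_{[0,1]^d}f(\boldsymbol{x})e^{-2\pi i\boldsymbol{k}\cdot\boldsymbol{x}}\,\mathrm{d}\boldsymbol{x}$ (terms with $\gamma_u=0$ are omitted). **Rank-1 lattices.** For $n\in\mathbb{N}$ and an integer vector $\boldsymbol{g}=(g_1,\ldots,g_d)$, $P_{n,\boldsymbol{g}}=\{(\{ig_1/n\},\ldots,\{ig_d/n\})\mid 0\le i<n\}$, where $\{\cdot\}$ is the fractional part (applied componentwise to vectors). **Aliasing-free frequencies.** A frequency $\boldsymbol{k}\in\mathcal{A}_d$ is aliasing-free for $(n,\boldsymbol{g})$ if no $\boldsymbol{m}\in\mathcal{A}_d\setminus\{\boldsymbol{k}\}$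 satisfies $\boldsymbol{m}\cdot\boldsymbol{g}\equiv\boldsymbol{k}\cdot\boldsymbol{g}\pmod n$. For lattices $(n_t,\boldsymbol{g}_t)$, $t=1,\ldots,L$, put $U_t(\boldsymbol{k})=1$ if $\boldsymbol{k}$ is aliasing-free for $(n_t,\boldsymbol{g}_t)$ and $U_t(\boldsymbol{k})=0$ otherwise, and $\xi(\boldsymbol{k})=\sum_{t=1}^LU_t(\boldsymbol{k})$. **Algorithm LC.** Input: $\mathcal{A}_d$, $c\in(1,\infty)$, $\delta\in(0,1)$. Set $L_{\max}=\left\lceil\left(\frac{c}{c-1}\right)^2\frac{\log|\mathcal{A}_d|-\log\delta}{2}\right\rceil$ and $\eta=c(|\mathcal{A}_d|-1)$. Let $\mathcal{P}_{\mathcal{A}_d}$ be the set of primes $n$ such that the vectors $\boldsymbol{k}\bmod n$ (componentwise), $\boldsymbol{k}\in\mathcal{A}_d$, are pairwise distinct, and let $p_1<\cdots<p_{L_{\max}}$ be the $L_{\max}$ smallest elements of $\mathcal{P}_{\mathcal{A}_d}$ greater than $\eta$. Start with $t=0$, $\mathcal{B}_d=\varnothing$. While $|\mathcal{B}_d|<|\mathcal{A}_d|$ and $t<L_{\max}$: replace $t$ by $t+1$; set $n_t=p_t$; draw $\boldsymbol{g}_t$ uniformly at random from $\{1,\ldots,n_t\}^d$ (independently of all previous draws); let $\mathcal{A}_{d,t}$ be the set of $\boldsymbol{k}\in\mathcal{A}_d$ aliasing-free for $(n_t,\boldsymbol{g}_t)$; if $\mathcal{A}_{d,t}\not\subseteq\mathcal{B}_d$,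 replace $\mathcal{B}_d$ by $\mathcal{B}_d\cup\mathcal{A}_{d,t}$, otherwise replace $t$ by $t-1$ (discarding the draw). Output: $(n_1,\boldsymbol{g}_1),\ldots,(n_L,\boldsymbol{g}_L)$ with $L=t$. The total number of points is $N=\sum_{t=1}^Ln_t$. Also $N_{\mathcal{A}_d}=\max_{1\le j\le d}\big(\max_{\boldsymbol{k}\in\mathcal{A}_d}k_j-\min_{\boldsymbol{h}\in\mathcal{A}_d}h_j\big)$. **Approximation algorithm.** Write $P_{n_t,\boldsymbol{g}_t}=\{\boldsymbol{y}^{(t)}_0,\ldots,\boldsymbol{y}^{(t)}_{n_t-1}\}$ and, for a shift $\boldsymbol{\Delta}\in[0,1]^d$, $\boldsymbol{y}^{(t)}_{i,\boldsymbol{\Delta}}=\{\boldsymbol{y}^{(t)}_i+\boldsymbol{\Delta}\}$. Then $A_{N,\boldsymbol{\Delta}}^{\mathrm{mult}}(f)(\boldsymbol{x})=\sum_{\boldsymbol{k}\in\mathcal{A}_d}\widehat f_{N,\boldsymbol{\Delta}}^{\mathrm{mult}}(\boldsymbol{k})e^{2\pi i\boldsymbol{k}\cdot\boldsymbol{x}}$ with $\widehat f_{N,\boldsymbol{\Delta}}^{\mathrm{mult}}(\boldsymbol{k})=\frac1{\xi(\boldsymbol{k})}\sum_{t=1}^L\frac{U_t(\boldsymbol{k})}{n_t}\sum_{i=0}^{n_t-1}f(\boldsymbol{y}_{i,\boldsymbol{\Delta}}^{(t)})e^{-2\pi i\boldsymbol{k}\cdot\boldsymbol{y}_{i,\boldsymbol{\Delta}}^{(t)}}$,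 and $\boldsymbol{\Delta}$ is uniformly distributed on $[0,1]^d$. It is well defined when $\xi(\boldsymbol{k})\ge1$ for all $\boldsymbol{k}\in\mathcal{A}_d$; ''with probability at least $1-\delta$'' means that the event that the algorithm is well defined and the stated bound holds has probability at least $1-\delta$. **Error.** $\mathrm{err}_2^{\mathrm{rand}}(A_{N,\boldsymbol{\Delta}}^{\mathrm{mult}},H_{d,\alpha,\boldsymbol{\gamma}})=\sup_{\|f\|_{d,\alpha,\boldsymbol{\gamma}}\le1}\left(\int_{[0,1]^d}\|f-A_{N,\boldsymbol{\Delta}}^{\mathrm{mult}}(f)\|_{L_2([0,1]^d)}^2\,\mathrm{d}\boldsymbol{\Delta}\right)^{1/2}$ (for fixed lattices). *)

(* Defs.v *)
From HB Require Import structures.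
From mathcomp Require Import all_boot all_order all_algebra.
From mathcomp Require Import finmap complex.
From mathcomp Require Import all_classical all_reals all_analysis.

Set Implicit Arguments.
Unset Strict Implicit.
Unset Printing Implicit Defensive.

Import Order.TTheory GRing.Theory Num.Theory.
Import numFieldNormedType.Exports.

Local Open Scope classical_set_scope.
Local Open Scope ring_scope.

Section UnitCube.
Context {R : realType}.
Local Notation MR := (measurableTypeR R).

Definition tuple_cons n (p : MR * n.-tuple MR) : n.+1.-tuple MR :=
  [tuple of p.1 :: p.2].

Lemma measurable_tuple_cons n : measurable_fun setT (@tuple_cons n).
Proof.
exact: (measurable_cons (@measurable_fst _ _ _ _) (@measurable_snd _ _ _ _)).
Qed.

HB.instance Definition _ n :=
  isMeasurableFun.Build _ _ _ _ (@tuple_cons n) (@measurable_tuple_cons n).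

(** Lebesgue measure on [[0,1]^n], as the [n]-fold product of the uniform
    probability on [[0,1]], which is Lebesgue measure restricted to [[0,1]].
    The library has a product sigma-algebra on tuples but no topology, hence
    the passage through [cube_point] for continuous functions. *)
Fixpoint cube_measure (n : nat) : probability (n.-tuple MR) R :=
  match n with
  | 0 => dirac [tuple]
  | m.+1 => distribution
      (uniform_prob (@ltr01 R) \x cube_measure m)%E (tuple_cons (n:=m))
  end.

Definition cube_point d (t : d.-tuple MR) : 'rV[R]_d := \row_j tnth t j.

Definition cube_cintegral d (f : 'rV[R]_d -> R[i]) : R[i] :=
  ((\int[cube_measure d]_t complex.Re (f (cube_point t)))
   +i* (\int[cube_measure d]_t complex.Im (f (cube_point t))))%C.

Definition cube_L2norm d (f : 'rV[R]_d -> R[i]) : \bar R :=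
  Lnorm (cube_measure d) 2%:E (fun t => (Normc.normc (f (cube_point t)))%:E).

End UnitCube.

Section Korobov.
Context {R : realType} {d : nat}.
Implicit Types (gamma : {fset nat} -> R) (alpha M : R) (k : 'rV[int]_d).

Definition expi2pi (t : R) : R[i] :=
  (cos (2 * pi * t) +i* sin (2 * pi * t))%C.

Definition freq_dot k (x : 'rV[R]_d) : R := \sum_(j < d) (k 0 j)%:~R * x 0 j.

Definition fourier_coef (f : 'rV[R]_d -> R[i]) k : R[i] :=
  cube_cintegral (fun x => f x * expi2pi (- freq_dot k x)).

(** Coordinates are numbered from 0, so the set [u] of positive integers is
    represented by [{j - 1 | j in u}]. *)
Definition supp k : {fset nat} := [fset nat_of_ord j | j : 'I_d & k 0 j != 0]%fset.

Definition korobov_r alpha gamma k : \bar R :=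
  if gamma (supp k) == 0 then +oo%E
  else ((gamma (supp k))^-1
        * \prod_(j < d | k 0 j != 0) (`|k 0 j|%:~R `^ alpha))%:E.

Definition korobov_norm alpha gamma (f : 'rV[R]_d -> R[i]) : \bar R :=
  sqrte (\esum_(k in [set k | (gamma (supp k) != 0)%R])
    (korobov_r alpha gamma k ^+ 2 * (Normc.normc (fourier_coef f k) ^+ 2)%R%:E))%E.

(** Functions on [[0,1]^d] that are 1-periodic in each variable are
    represented by their periodic extensions to the whole space. *)
Definition in_korobov alpha gamma (f : 'rV[R]_d -> R[i]) : Prop :=
  [/\ continuous (f : 'rV[R]_d -> R[i]^o),
      forall x j, f (x + delta_mx 0 j) = f x,
      forall k, gamma (supp k) = 0 -> fourier_coef f k = 0
    & (korobov_norm alpha gamma f < +oo)%E].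

(** [fset_set] returns the empty set on infinite sets; this does not happen
    here, see [korobov_ball_finite]. *)
Definition korobov_ball alpha gamma M : {fset 'rV[int]_d} :=
  fset_set [set k | (korobov_r alpha gamma k <= M%:E)%E].

Lemma korobov_ball_finite alpha gamma M :
  0 < alpha -> (forall u, 0 <= gamma u) ->
  finite_set [set k : 'rV[int]_d | (korobov_r alpha gamma k <= M%:E)%E].
Proof.
move=> a0 g0.
pose F (B : {set 'I_d}) : {fset nat} := [fset nat_of_ord j | j : 'I_d & j \in B]%fset.
pose G := \sum_(B : {set 'I_d}) gamma (F B).
pose K := (G * `|M|) `^ alpha^-1.
pose N := `|Num.ceil K|%N.
have G0 : 0 <= G by apply: sumr_ge0.
have bnd k : (korobov_r alpha gamma k <= M%:E)%E -> forall j, (`|k 0 j| <= N%:Z)%R.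
  move=> rk j; have [->|kj0] := eqVneq (k 0 j) 0; first by rewrite normr0.
  move: rk; rewrite /korobov_r; case: eqVneq => [//|gk0]; rewrite lee_fin => rk.
  have gk : 0 < gamma (supp k) by rewrite lt_neqAle eq_sym gk0 g0.
  have gG : gamma (supp k) <= G.
    have -> : supp k = F (finset (fun j => k 0 j != 0)).
      apply/fsetP => i; apply/imfsetP/imfsetP => -[l /= lP ->]; exists l => //=;
        by move: lP; rewrite !inE.
    by rewrite /G (bigD1 (finset (fun j => k 0 j != 0)))//= lerDl sumr_ge0.
  have ge1 (l : 'I_d) : k 0 l != 0 -> 1 <= (`|k 0 l|%:~R : R) `^ alpha.
    move=> kl; have := @ge0_ler_powR R _ (ltW a0) 1 (`|k 0 l|%:~R).
    by rewrite powR1 !nnegrE ler01 ler0z normr_ge0 ler1z -gtz0_ge1 normr_gt0; apply.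
  have kjG : (`|k 0 j|%:~R : R) `^ alpha <= G * `|M|.
    have : (`|k 0 j|%:~R : R) `^ alpha <= gamma (supp k) * M.
      apply: (le_trans _ (_ : \prod_(j < d | k 0 j != 0) (`|k 0 j|%:~R `^ alpha) <= _)).
        rewrite (bigD1 j)//= ler_peMr ?powR_ge0//.
        elim/big_ind : _ => // [x y x1 y1|l /andP[kl _]]; last exact: ge1.
        by rewrite -[leLHS]mulr1 ler_pM.
      by rewrite -ler_pdivrMl.
    move=> /le_trans; apply.
    apply: (@le_trans _ _ (gamma (supp k) * `|M|)); first by rewrite ler_pM2l// ler_norm.
    by rewrite ler_wpM2r.
  have : (`|k 0 j|%:~R : R) <= K.
    have -> : (`|k 0 j|%:~R : R) = (`|k 0 j|%:~R `^ alpha) `^ alpha^-1.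
      by rewrite -powRrM mulfV ?gt_eqF// powRr1// ler0z.
    apply: ge0_ler_powR => //; rewrite ?nnegrE ?powR_ge0 ?invr_ge0 ?(ltW a0)//.
    exact: mulr_ge0.
  move=> /le_trans/(_ (Num.Theory.ceil_ge _)); rewrite ler_int => /le_trans; apply.
  by rewrite /N abszE ler_norm.
pose h (g : {ffun 'I_d -> 'I_(N + N).+1}) : 'rV[int]_d := \row_j ((g j)%:Z - N%:Z).
apply: (@sub_finite_set _ _ (h @` setT)); last exact/finite_image/finite_finset.
move=> k /= /bnd kN; exists [ffun j => inord `|(k 0 j + N%:Z)%R|%N] => //.
apply/rowP => j; rewrite mxE ffunE inordK.
  rewrite gez0_abs ?addrK//.
  by have /ler_normlP[+ _] := kN j; rewrite lerNl -subr_ge0 opprK.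
have /ler_normlP[k1 k2] := kN j.
rewrite ltnS -lez_nat gez0_abs; last by rewrite -lerBlDr sub0r lerNl.
by rewrite PoszD lerD2r.
Qed.

End Korobov.

Section Lattices.
Context {R : realType} {d : nat}.
Implicit Types (A : {fset 'rV[int]_d}) (g k : 'rV[int]_d)
  (lat : seq (nat * 'rV[int]_d)).

Definition frac (x : R) : R := x - (Num.floor x)%:~R.

Definition lattice_point (n : nat) g (i : nat) : 'rV[R]_d :=
  \row_j frac (i%:R * (g 0 j)%:~R / n%:R).

Definition shifted_point (n : nat) g (i : nat) (Delta : 'rV[R]_d) : 'rV[R]_d :=
  \row_j frac (lattice_point n g i 0 j + Delta 0 j).

Definition int_dot (k g : 'rV[int]_d) : int := \sum_(j < d) k 0 j * g 0 j.

Definition aliasing_free A (n : nat) g k : bool :=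
  ~~ has (fun m => (int_dot m g == int_dot k g %[mod n%:Z])%Z) (A `\ k)%fset.

(** A list of lattices is the list of the pairs [(n_t, g_t)]. *)
Definition xi A lat k : nat :=
  (\sum_(l <- lat) aliasing_free A l.1 l.2 k)%N.

Definition mult_coef A lat (f : 'rV[R]_d -> R[i]) (Delta : 'rV[R]_d) k : R[i] :=
  (xi A lat k)%:R^-1 * \sum_(l <- lat)
    (aliasing_free A l.1 l.2 k)%:R / l.1%:R *
    \sum_(i < l.1) f (shifted_point l.1 l.2 i Delta)
                   * expi2pi (- freq_dot k (shifted_point l.1 l.2 i Delta)).

Definition mult_approx A lat (f : 'rV[R]_d -> R[i]) (Delta x : 'rV[R]_d) : R[i] :=
  \sum_(k <- A) mult_coef A lat f Delta k * expi2pi (freq_dot k x).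

Definition err_rand alpha (gamma : {fset nat} -> R) A lat : \bar R :=
  ereal_sup [set sqrte (\int[cube_measure d]_D
       cube_L2norm (fun x => f x - mult_approx A lat f (cube_point D) x)%R ^+ 2)%E
    | f in [set f | in_korobov alpha gamma f /\
                    (korobov_norm alpha gamma f <= 1)%E]].

End Lattices.

Section LatticeConstruction.
Context {R : realType} {d : nat}.
Implicit Types (A : {fset 'rV[int]_d}) (c delta : R) (g : 'rV[int]_d).

(** The argument of the ceiling is positive when [A] is nonempty and
    [0 < delta < 1 < c]. *)
Definition lc_Lmax A c delta : nat :=
  `|Num.ceil ((c / (c - 1)) ^+ 2 * ((ln #|` A|%:R - ln delta) / 2))|%N.

Definition lc_eta A c : R := c * (#|` A|%:R - 1).

(** Meaningful for nonempty [A]: [k0] only serves as a default value. *)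
Definition freq_width A : int :=
  let k0 := head 0 A in
  \big[Num.max/0]_(j < d)
    (\big[Num.max/k0 0 j]_(k <- A) k 0 j - \big[Num.min/k0 0 j]_(h <- A) h 0 j).

Definition admissible_prime A (n : nat) : bool :=
  prime n && uniq [seq map_mx (modz ^~ n%:Z) k | k <- A].

Lemma admissible_prime_above A (x : R) :
  exists n, (x < n%:R) && admissible_prime A n.
Proof.
pose N := (\sum_(k <- A) \sum_(j < d) `|k 0%R j|)%N.
have kN k j : k \in A -> (`|k 0%R j| <= N)%N.
  move=> kA; rewrite /N (big_rem k)//= (bigD1 j)//= -addnA.
  exact: leq_addr.
have [n nM np] := prime_above (maxn (N + N) (Num.truncn x)).
exists n; apply/andP; split.
  apply: (lt_le_trans (truncnS_gt x)); rewrite ler_nat.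
  exact: leq_ltn_trans (leq_maxr _ _) nM.
rewrite /admissible_prime np map_inj_in_uniq ?fset_uniq//= => k h kA hA /matrixP kh.
apply/matrixP => i j; rewrite ord1; have := kh 0 j; rewrite !mxE => /eqP.
rewrite eqz_mod_dvd dvdzE/= => dv; apply/eqP; rewrite -subr_eq0 -absz_eq0.
apply: contraTT dv => nz; apply/negP => /dvdn_leq; rewrite lt0n => /(_ nz).
apply/negP; rewrite -ltnNge; apply: leq_ltn_trans nM.
rewrite leq_max; apply/orP; left; apply: leq_trans (leq_add (kN _ j kA) (kN _ j hA)).
by rewrite -lez_nat PoszD !abszE ler_normB.
Qed.

Definition next_admissible A (x : R) : nat := ex_minn (admissible_prime_above A x).

(** [lc_prime A c t] is [p_(t+1)] *)
Fixpoint lc_prime A c (t : nat) : nat :=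
  match t with
  | 0 => next_admissible A (lc_eta A c)
  | s.+1 => next_admissible A (lc_prime A c s)%:R
  end.

(** The state is the pair of the set [B_d] and of the list of the lattices
    accepted so far; the counter [t] is the length of this list. *)
Definition lc_state : Type := ({fset 'rV[int]_d} * seq (nat * 'rV[int]_d))%type.

Definition lc_running A c delta (st : lc_state) : bool :=
  (#|` st.1| < #|` A|)%N && (size st.2 < lc_Lmax A c delta)%N.

Definition lc_modulus A c (st : lc_state) : nat := lc_prime A c (size st.2).

Definition lc_step A c delta (st : lc_state) g : lc_state :=
  if lc_running A c delta st then
    let n := lc_modulus A c st in
    let At := [fset k in A | aliasing_free A n g k]%fset in
    if (At `<=` st.1)%fset then st
    else ((st.1 `|` At)%fset, rcons st.2 (n, g))
  else st.

Fixpoint lc_run A c delta (draw : nat -> 'rV[int]_d) (i : nat) : lc_state :=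
  match i with
  | 0 => (fset0, [::])
  | m.+1 => lc_step A c delta (lc_run A c delta draw m) (draw m)
  end.

Definition lc_output A c delta draw (lat : seq (nat * 'rV[int]_d)) : Prop :=
  exists2 i, ~~ lc_running A c delta (lc_run A c delta draw i)
           & lat = (lc_run A c delta draw i).2.

(** [G i] is the [i]-th draw (accepted or discarded). As long as the loop is
    running, its conditional law given all the previous draws is uniform on
    [{1, ..., n}^d], where the modulus [n] is determined by these draws. *)
Definition lc_draws A c delta {dO} {Omega : measurableType dO}
    (P : probability Omega R) (G : nat -> Omega -> 'rV[int]_d) : Prop :=
  (forall i v, measurable (G i @^-1` [set v])) /\
  forall i (h : nat -> 'rV[int]_d), lc_running A c delta (lc_run A c delta h i) ->
  let n := lc_modulus A c (lc_run A c delta h i) in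
  forall v : 'rV[int]_d, (forall j, 1 <= v 0 j <= n%:Z) ->
    P ([set w | forall m, (m < i)%N -> G m w = h m] `&` G i @^-1` [set v])
    = ((n ^ d)%:R^-1%:E * P [set w | forall m, (m < i)%N -> G m w = h m])%E.

End LatticeConstruction.

(* Main.v *)
Require Import Defs.
From HB Require Import structures.
From mathcomp Require Import all_boot all_order all_algebra.
From mathcomp Require Import finmap complex.
From mathcomp Require Import all_classical all_reals all_analysis.
From mathcomp Require Import measurable_realfun.
From mathcomp Require Import ring lra zify.

(** Construction of the lattices.  For a lattice with a prime number [n] of points,
    [n > c (|A| - 1)], every frequency of [A] is aliasing-free for a proportion at
    least [1 - 1/c] of the generating vectors.  With [q = 1/c], [u] uncovered
    frequencies and [s] lattices still to be accepted, [u q^s] is a supermartingale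
    along the loop, discarded draws included, so the loop fails with probability at
    most [|A| q^Lmax], which is at most [delta] because [2 (1 - q)^2 <= - ln q].  The
    additional term [2^s ((1 + q) / 2)^j] bounds the probability that the loop is
    still running after [j] draws.

    Error.  If every [k] in [A] has [xi k >= 1], the bound holds deterministically.
    For a trigonometric polynomial with coefficients [a], averaging over the shift
    makes all cross terms vanish (Parseval in [x], then in the shift), and the mean
    square error is at most [(L + 1)] times the sum of [|a_m|^2] over [m] outside [A],
    since for each lattice at most one aliasing-free frequency aliases with [m].  A
    function of the unit ball of the Korobov space has summable Fourier coefficients
    because [2 alpha > 1], hence is a uniform limit of its partial Fourier sums; this
    is shown by averaging against powers of the trigonometric polynomial
    [prod_j (1 + cos (2 pi (y_j - x_j))) / 2], which peaks at [x]. *)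

Set Implicit Arguments.
Unset Strict Implicit.
Unset Printing Implicit Defensive.

Import Order.TTheory GRing.Theory Num.Theory.
Import numFieldNormedType.Exports.
Import Normc.

Local Open Scope classical_set_scope.
Local Open Scope ring_scope.

(** * Aliasing for a random generating vector *)

(** Discarding draws is the obstacle on the probabilistic side. An accepted vector is no longer
    uniform: its law depends on the set already covered, so the indicators [U_t(k)] of the accepted
    lattices are not independent and a concentration inequality for independent variables does not
    apply to them directly. The number of draws is not bounded either, so termination has to be
    proved along with coverage. The form of [lc_Lmax] is that of Hoeffding's inequality; here it
    enters only through [q <= exp (- 2 (1 - q)^2)].

    On the analytic side the obstacle is that the algorithm samples [f] at points. Approximation of
    [f] in the mean says nothing about these samples, whereas the Korobov norm controls only Fourier
    coefficients. Uniform approximation bridges the two: it changes every computed coefficient,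
    hence the mean square error, by an arbitrarily small amount. *)

Lemma neg_ln_ge_sqr (R : realType) (q : R) : 0 < q -> q <= 1 ->
  2 * (1 - q) ^+ 2 <= - ln q.
Proof.
move=> q0 q1.
(* [f] vanishes at 1 and is nondecreasing, since its derivative is [(2 x - 1)^2 / x]. *)
pose f (x : R) := ln x + 2 * (1 - x) ^+ 2.
have df (x : R) : 0 < x -> is_derive x 1 f (x^-1 - 4 * (1 - x)).
  move=> x0; have := is_derive1_ln x0 => dln.
  apply: is_derive_eq; rewrite /GRing.scale/=.
  by lra.
have : f q <= f 1.
  apply: (@ger0_derive1_ndecr _ f q 1) => //.
  - by move=> x; rewrite in_itv/= => /andP[qx _]; have [] := df x (lt_trans q0 qx).
  - move=> x; rewrite in_itv/= => /andP[qx _].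
    have x0 := lt_trans q0 qx.
    rewrite derive1E; have [_ ->] := df x x0.
    rewrite subr_ge0 -(ler_pM2l x0) mulfV ?gt_eqF//.
    by have := sqr_ge0 (2 * x - 1); nra.
  - apply: continuous_in_subspaceT => x; rewrite inE/= in_itv/= => /andP[qx _].
    apply: differentiable_continuous.
    by apply/derivable1_diffP; have [] := df x (lt_le_trans q0 qx).
by rewrite /f ln1 subrr expr0n/= mulr0 addr0; lra.
Qed.

(** In logarithms, with [q = 1/c]: the factor [c / (c - 1)] is [1 / (1 - q)], so [lc_Lmax] is at
    least [(ln |A| - ln delta) / (2 (1 - q)^2)], and [2 (1 - q)^2] is at most [- ln q]. *)
Lemma lc_Lmax_bound (R : realType) (d : nat) (A : {fset 'rV[int]_d}) (c delta : R) :
  1 < c -> 0 < delta -> (0 < #|` A|)%N ->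
  #|` A|%:R * c^-1 ^+ lc_Lmax A c delta <= delta.
Proof.
move=> c1 d0 A0.
have c0 : 0 < c by exact: lt_trans c1.
have q0 : 0 < c^-1 by rewrite invr_gt0.
have q1 : c^-1 < 1 by rewrite invf_lt1.
have A0' : 0 < #|` A|%:R :> R by rewrite ltr0n.
rewrite -ler_ln ?posrE ?mulr_gt0 ?exprn_gt0// lnM ?posrE ?exprn_gt0// lnXn//.
set L := lc_Lmax A c delta.
have H := neg_ln_ge_sqr q0 (ltW q1).
have HL : (c / (c - 1)) ^+ 2 * ((ln #|` A|%:R - ln delta) / 2) <= L%:R.
  rewrite /L /lc_Lmax; set X := (X in Num.ceil X).
  apply: (le_trans (ceil_ge X)).
  by rewrite natr_absz ler_int ler_norm.
have qc : c / (c - 1) = (1 - c^-1)^-1.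
  by field; rewrite !gt_eqF//= subr_gt0.
rewrite qc exprVn ler_pdivrMl in HL; last first.
  by rewrite exprn_gt0// subr_gt0.
rewrite -[X in _ + X]mulr_natl.
have HH : L%:R * (2 * (1 - c^-1) ^+ 2) <= L%:R * - ln c^-1 by rewrite ler_wpM2l.
by lra.
Qed.

Lemma uniq_map_inj (T1 T2 : eqType) (f : T1 -> T2) (s : seq T1) :
  uniq (map f s) -> {in s &, injective f}.
Proof.
elim: s => [//|a s IH]/= /andP[fa us] x y; rewrite !inE.
move=> /predU1P[->|xs] /predU1P[->|ys]//; last exact: IH.
- by move=> fay; move: fa; rewrite fay map_f.
- by move=> fxa; move: fa; rewrite -fxa map_f.
Qed.

Section Counting.
Local Close Scope classical_set_scope.
Variable d : nat.
Implicit Types (A : {fset 'rV[int]_d}) (k m z g : 'rV[int]_d).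

(** The successor turns ['I_n] into [{1, ..., n}], so that an average over the draws becomes a sum
    over a finite type. *)
Definition draw_vec n (x : {ffun 'I_d -> 'I_n}) : 'rV[int]_d :=
  \row_j (x j).+1%:Z.

Lemma draw_vec_inj n : injective (@draw_vec n).
Proof.
move=> x y /rowP xy; apply/ffunP => j; have := xy j; rewrite !mxE => -[].
exact: val_inj.
Qed.

Lemma draw_vec_bound n (x : {ffun 'I_d -> 'I_n}) j : 1 <= draw_vec x 0 j <= n%:Z.
Proof. by rewrite mxE; have := ltn_ord (x j); lia. Qed.

Lemma int_dotB m k g : int_dot (m - k) g = int_dot m g - int_dot k g.
Proof.
by rewrite /int_dot -sumrB; apply: eq_bigr => j _; rewrite !mxE mulrBl.
Qed.

(* Replacing coordinate [j0] by an arbitrary value loses no information on the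
   solution set, since that coordinate is determined by the other ones. *)
Lemma card_congruence n z j0 : prime n -> ~~ (n%:Z %| z 0%R j0)%Z ->
  (#|[set x : {ffun 'I_d -> 'I_n} | (n%:Z %| int_dot z (draw_vec x))%Z]| * n
     <= n ^ d)%N.
Proof.
move=> np nz; set S := [set x | _].
pose upd (p : {ffun 'I_d -> 'I_n} * 'I_n) : {ffun 'I_d -> 'I_n} :=
  [ffun j => if j == j0 then p.2 else p.1 j].
have inj : {in finset.setX S [set: 'I_n]%SET &, injective upd}.
  move=> [x s] [y t]; rewrite !finset.in_setX !inE/= !andbT => xS yS /ffunP xy.
  have st : s = t by have := xy j0; rewrite !ffunE eqxx.
  have xyj j : j != j0 -> x j = y j.
    by move=> jj0; have := xy j; rewrite !ffunE (negbTE jj0).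
  congr pair => //; apply/ffunP => j; have [->|] := eqVneq j j0; last exact: xyj.
  (* Subtracting the two congruences leaves [z_j0 (x_j0 - y_j0)]. As [n] is coprime to [z_j0], it
     divides a difference of two elements of [{1, ..., n}], which must vanish. *)
  have := rpredB xS yS.
  rewrite /int_dot -sumrB (bigD1 j0)//= big1 => [|i ij0]; last first.
    by rewrite !mxE xyj// subrr.
  rewrite addr0 !mxE -mulrBr Gauss_dvdzr; last first.
    by rewrite /coprimez; rewrite -[X in X == _]/(gcdz n (z 0 j0)) /gcdz/= eqz_nat
      -/(coprime n `|z 0 j0|) prime_coprime//.
  have /andP[? ?] : (x j0 < n)%N && (y j0 < n)%N by rewrite !ltn_ord.
  rewrite dvdzE/= => dv; apply: val_inj => /=; apply/eqP.
  have : (`|((x j0).+1%:Z - (y j0).+1%:Z)%R| < n)%N by lia.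
  rewrite ltnNge; apply: contraNT => ne; apply: dvdn_leq => //.
  by rewrite absz_gt0 subr_eq0 eqz_nat eqSS.
have := max_card (upd @: finset.setX S [set: 'I_n]%SET).
by rewrite card_in_imset// finset.cardsX finset.cardsT card_ord card_ffun !card_ord.
Qed.

(** Union bound over the other frequencies [m]: admissibility of [n] yields a coordinate where
    [m - k] is nonzero modulo [n], so each [m] spoils at most a fraction [1/n] of the vectors. *)
Lemma card_not_aliasing_free A n k : admissible_prime A n -> k \in A ->
  (#|[set x : {ffun 'I_d -> 'I_n} | ~~ aliasing_free A n (draw_vec x) k]| * n
     <= #|` A|.-1 * n ^ d)%N.
Proof.
move=> /andP[np un] kA.
pose D m := [set x : {ffun 'I_d -> 'I_n} | (n%:Z %| int_dot (m - k)%R (draw_vec x))%Z].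
have sub : [set x : {ffun 'I_d -> 'I_n} | ~~ aliasing_free A n (draw_vec x) k]
    \subset \bigcup_(m : (A `\ k)%fset) D (val m).
  apply/fintype.subsetP => x; rewrite inE negbK => /hasP[m mA mk].
  apply/finset.bigcupP; exists [` mA]%fset => //.
  by rewrite inE int_dotB -eqz_mod_dvd.
have leU : (#|\bigcup_(m : (A `\ k)%fset) D (val m)| <= \sum_(m : (A `\ k)%fset) #|D (val m)|)%N.
  by apply: (big_ind2 (fun (X : {set _}) y => (#|X| <= y)%N)) => // [|X x Y y Xx Yy];
    rewrite ?cards0// (leq_trans (leq_card_setU _ _))// leq_add.
apply: (leq_trans (leq_mul (leq_trans (subset_leq_card sub) leU) (leqnn n))).
have -> : #|` A|.-1 = #|{: (A `\ k)%fset}|.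
  by rewrite -cardfE; have := cardfsD1 k A; rewrite kA => ->.
rewrite -sum_nat_const big_distrl/=; apply: leq_sum => m _.
have := fsvalP m; rewrite !inE => /andP[mk mA].
have [j nj] : exists j, ~~ (n%:Z %| (fsval m - k)%R 0%R j)%Z.
  apply: contra_neqP mk => /forallNP nj.
  apply: (uniq_map_inj un) => //; apply/rowP => j; rewrite !mxE.
  have /negP := nj j; rewrite negbK !mxE -eqz_mod_dvd => /eqP.
  exact.
exact: card_congruence np nj.
Qed.
End Counting.

(** * The potential of the construction *)

(** One draw, summed over the [N] vectors: [a] are accepted, [S] frequencies are uncovered before
    the draw, [U] is the total uncovered afterwards, [Q = q^s]. Discarding a draw gains
    [(N - a) S (1 - q) >= 0] in the first part; the second part uses only [a >= N (1 - q)]. *)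
Lemma potential_arith (R : realFieldType) (S N q Q a p U : R) :
  0 <= S -> q <= 1 -> 0 <= Q -> 0 <= p -> a <= N -> N * (1 - q) <= a ->
  U <= S * (q * N) ->
  (U - (N - a) * S) * Q + a * p + (N - a) * (S * (q * Q) + 2 * p)
    <= N * (S * (q * Q) + (1 + q) * p).
Proof.
move=> S0 q1 Q0 p0 aN aq US.
have -> : N * (S * (q * Q) + (1 + q) * p) = (S * (q * N)) * Q + N * (1 + q) * p by ring.
have -> : (U - (N - a) * S) * Q + a * p + (N - a) * (S * (q * Q) + 2 * p)
  = (U - (N - a) * S * (1 - q)) * Q + (2 * N - a) * p by ring.
rewrite lerD ?ler_wpM2r//; last by lra.
have : 0 <= (N - a) * S * (1 - q) by rewrite !mulr_ge0 ?subr_ge0.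
by lra.
Qed.

Lemma potential_exprS (R : realFieldType) (q : R) s j :
  2 ^+ s.+1 * ((1 + q) / 2) ^+ j.+1 = (1 + q) * (2 ^+ s * ((1 + q) / 2) ^+ j) :> R.
Proof. by rewrite !exprS; field. Qed.

Section Potential.
Context {R : realType} {d : nat}.
Variables (A : {fset 'rV[int]_d}) (c delta : R).
Hypothesis c1 : 1 < c.
Implicit Types (st : @lc_state d) (B : {fset 'rV[int]_d}).

Lemma next_admissibleP (x : R) :
  x < (next_admissible A x)%:R /\ admissible_prime A (next_admissible A x).
Proof. by rewrite /next_admissible; case: ex_minnP => n /andP[]. Qed.

Lemma lc_primeP t : lc_eta A c < (lc_prime A c t)%:R /\
  admissible_prime A (lc_prime A c t).
Proof.
elim: t => [|t [eta_t _]]; first exact: next_admissibleP.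
have [lt_t ?] := next_admissibleP (lc_prime A c t)%:R.
by split => //; apply: lt_trans lt_t.
Qed.

(** This is what the threshold [eta] is for: [n > c (|A| - 1)] turns the union bound [(|A| - 1) / n]
    into [1/c]. *)
Lemma card_not_aliasing_free_le t k (n := lc_prime A c t) : k \in A ->
  #|[set x : {ffun 'I_d -> 'I_n} | ~~ aliasing_free A n (draw_vec x) k]%SET|%:R
    <= c^-1 * (n ^ d)%:R.
Proof.
move=> kA; have [etan adm] := lc_primeP t.
have := card_not_aliasing_free adm kA; rewrite -/n in etan adm *.
set m := #|_| => mn.
have n0 : 0 < n%:R :> R by rewrite ltr0n prime_gt0//; case/andP: adm.
have c0 : 0 < c by exact: lt_trans c1.
rewrite ler_pdivlMl// -(ler_pM2l n0).
have A1 : #|` A|.-1%:R = #|` A|%:R - 1 :> R.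
  by rewrite -subn1 natrB// cardfs_gt0; apply/fset0Pn; exists k.
move: mn; rewrite -(ler_nat R) !natrM A1 => mn.
move: etan; rewrite /lc_eta => etan.
have N0 : 0 <= (n ^ d)%:R :> R by rewrite ler0n.
have h1 : c * (m%:R * n%:R) <= c * ((#|` A|%:R - 1) * (n ^ d)%:R) by rewrite ler_pM2l.
have h2 : c * (#|` A|%:R - 1) * (n ^ d)%:R <= n%:R * (n ^ d)%:R.
  by rewrite ler_wpM2r// ltW.
by lra.
Qed.

Definition uncovered B : nat := #|` (A `\` B)%fset|.

(** Bounds the conditional probability, in state [st], that [A] is still not covered after [j] more
    draws. In the second summand an acceptance halves [2^s] and a rejection keeps it; with
    acceptance probability at least [1 - q], [q = 1/c], the mean factor is at most
    [(1 - q) / 2 + q = (1 + q) / 2]. *)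
Definition potential (j : nat) st : R :=
  let s := (lc_Lmax A c delta - size st.2)%N in
  (uncovered st.1)%:R * c^-1 ^+ s
  + (0 < uncovered st.1)%N%:R * (2 ^+ s * ((1 + c^-1) / 2) ^+ j).

Lemma uncovered_gt0 B : ~~ (A `<=` B)%fset -> (0 < uncovered B)%N.
Proof. by rewrite -fsetD_eq0 /uncovered cardfs_gt0. Qed.

Lemma potential_ge0 j st : 0 <= potential j st.
Proof.
have c0 : 0 < c by exact: lt_trans c1.
have q0 : 0 <= c^-1 by rewrite invr_ge0 ltW.
by rewrite addr_ge0 ?mulr_ge0 ?exprn_ge0 ?divr_ge0 ?addr_ge0.
Qed.

(** The loop can stop short of coverage only after [lc_Lmax] acceptances; then [s = 0] and the first
    summand counts the uncovered frequencies. *)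
Lemma potential_ge1_stopped j st : (st.1 `<=` A)%fset ->
  ~~ lc_running A c delta st -> ~~ (A `<=` st.1)%fset -> 1 <= potential j st.
Proof.
move=> BA nrun AB; have u0 := uncovered_gt0 AB.
have c0 : 0 < c by exact: lt_trans c1.
have q0 : 0 <= c^-1 by rewrite invr_ge0 ltW.
have : (#|` st.1| < #|` A|)%N.
  by rewrite -subn_gt0 -cardfsDS.
move=> lt; move: nrun; rewrite /lc_running lt/= -leqNgt => Ls.
rewrite /potential; have -> : (lc_Lmax A c delta - size st.2 = 0)%N by apply/eqP.
rewrite expr0 mulr1 -[leLHS]addr0 lerD ?ler1n//.
by rewrite expr0 mul1r mulr_ge0 ?exprn_ge0 ?divr_ge0 ?addr_ge0.
Qed.

(** With no draws left the second summand is [2^s], which alone is at least 1. *)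
Lemma potential_ge1_start st : ~~ (A `<=` st.1)%fset -> 1 <= potential 0 st.
Proof.
move=> /uncovered_gt0 u0.
have c0 : 0 < c by exact: lt_trans c1.
have q0 : 0 <= c^-1 by rewrite invr_ge0 ltW.
rewrite /potential u0 mul1r expr0 mulr1 -[leLHS]add0r lerD ?mulr_ge0 ?exprn_ge0//.
by rewrite exprn_ege1// ler1n.
Qed.

Lemma uncoveredU B (P : pred 'rV[int]_d) :
  uncovered (B `|` [fset k in A | P k])%fset = (\sum_(k <- (A `\` B)%fset) ~~ P k)%N.
Proof.
have -> : (\sum_(k <- (A `\` B)%fset) ~~ P k = \sum_(k <- (A `\` B)%fset | ~~ P k) 1)%N.
  by rewrite [RHS]big_mkcond/=; apply: eq_bigr => k _; case: (P k).
rewrite big_fset_condE -card_fset_sum1; congr #|` _|.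
apply/fsetP => k; rewrite !inE.
by case: (k \in A); case: (k \in B); case: (P k).
Qed.

(* Conditioning on acceptance can only raise the probability that a given
   uncovered frequency gets covered, since covering it forces acceptance. *)
Lemma potential_step j st (n := lc_modulus A c st) :
  (st.1 `<=` A)%fset -> lc_running A c delta st ->
  \sum_(x : {ffun 'I_d -> 'I_n}) potential j (lc_step A c delta st (draw_vec x))
    <= (n ^ d)%:R * potential j.+1 st.
Proof.
move=> BA run.
have c0 : 0 < c by exact: lt_trans c1.
set q := c^-1.
have q0 : 0 < q by rewrite invr_gt0.
have q1 : q < 1 by rewrite invf_lt1.
have /andP[BltA sL] := run.
set B := st.1 in BA BltA *.
have S0 : (0 < uncovered B)%N by rewrite /uncovered cardfsDS// subn_gt0.
set S : R := (uncovered B)%:R.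
have S0' : 0 < S by rewrite ltr0n.
set N : R := (n ^ d)%:R.
pose s := (lc_Lmax A c delta - (size st.2).+1)%N.
have sE : (lc_Lmax A c delta - size st.2)%N = s.+1 by rewrite /s subnSK.
set rho := (1 + q) / 2.
have rho0 : 0 < rho by rewrite divr_gt0 ?addr_gt0.
pose AF (x : {ffun 'I_d -> 'I_n}) k := aliasing_free A n (draw_vec x) k.
pose acc x := ~~ ([fset k in A | AF x k] `<=` B)%fset.
pose u x : R := \sum_(k <- (A `\` B)%fset) (~~ AF x k)%:R.
have ux x : u x = (uncovered (B `|` [fset k in A | AF x k])%fset)%:R.
  by rewrite uncoveredU natr_sum.
pose p : R := 2 ^+ s * rho ^+ j.
have p0 : 0 < p by rewrite mulr_gt0 ?exprn_gt0.
(* An acceptance lowers the exponent from [s + 1] to [s]; a rejection leaves the state unchanged,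
   with second summand [2^(s+1) rho^j = 2 p]. *)
have pointwise x : potential j (lc_step A c delta st (draw_vec x)) <=
    (acc x)%:R * (u x * q ^+ s + p) + (1 - (acc x)%:R) * (S * q ^+ s.+1 + 2 * p).
  rewrite /lc_step run -/n -/(AF x) /acc; case: ifPn => _ /=.
    rewrite mul0r add0r subr0 mul1r /potential -/B -/S sE S0 mul1r exprS /p.
    by rewrite [2 ^+ s.+1]exprS -mulrA lexx.
  rewrite mul1r subrr mul0r addr0 /potential/= -/B -ux size_rcons -/s -/rho -/p -/q.
  by rewrite lerD2l ler_piMl// ?(ltW p0)// lern1 leq_b1.
apply: (le_trans (ler_sum _ (fun x _ => pointwise x))).
pose a : R := \sum_x (acc x)%:R.
(* A discarded draw covers nothing new, so [u x = S] there. *)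
have accu x : (acc x)%:R * u x = u x - (1 - (acc x)%:R) * S.
  rewrite /acc; case: (boolP (_ `<=` _)%fset) => /= [sub|_]; last by rewrite mul1r subrr mul0r subr0.
  rewrite mul0r subr0 mul1r; apply/esym/eqP; rewrite subr_eq0 ux; apply/eqP.
  by have /fsetUidPl -> := sub.
have sumu : \sum_x u x <= S * (q * N).
  rewrite /u exchange_big/= /S /uncovered card_fset_sum1 natr_sum mulr_suml.
  rewrite big_seq [leRHS]big_seq; apply: ler_sum => k; rewrite inE => /andP[_ kA].
  rewrite mul1r -natr_sum; apply: le_trans (card_not_aliasing_free_le _ kA).
  rewrite ler_nat//.
  by rewrite -sum1dep_card [leqRHS]big_mkcond/= leq_sum// => x _; case: (AF x k).
have cardN : \sum_(x : {ffun 'I_d -> 'I_n}) 1 = N :> R.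
  by rewrite sumr_const card_ffun !card_ord.
have saccu : \sum_x (acc x)%:R * u x = \sum_x u x - (N - a) * S.
  under eq_bigr do rewrite accu.
  by rewrite sumrB -mulr_suml sumrB cardN.
have saccu0 : 0 <= \sum_x (acc x)%:R * u x.
  by apply: sumr_ge0 => x _; rewrite mulr_ge0// sumr_ge0.
have aN : a <= N.
  by rewrite -cardN; apply: ler_sum => x _; rewrite lern1 leq_b1.
(* The discarded draws leave all [S] frequencies uncovered, so [(N - a) S] is at most the sum of
   [u], itself at most [S q N]; divide by [S]. *)
have aq : N * (1 - q) <= a.
  rewrite -(ler_pM2l S0'); lra.
rewrite big_split/=.
have -> : \sum_x (acc x)%:R * (u x * q ^+ s + p)
    = (\sum_x u x - (N - a) * S) * q ^+ s + a * p.
  rewrite -saccu mulr_suml /a mulr_suml -big_split/=.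
  by apply: eq_bigr => x _; rewrite mulrDr mulrA.
rewrite -mulr_suml sumrB cardN -/a.
rewrite /potential -/B S0 -/S sE -/q -/rho mul1r.
rewrite potential_exprS exprS.
apply: potential_arith => //; try exact: ltW; exact/ltW/exprn_gt0.
Qed.

End Potential.

(** * The probability of covering all frequencies *)

Lemma sum_measure_disjoint d (T : measurableType d) (R : realType)
    (mu : {measure set T -> \bar R}) (J : finType) (F : J -> set T) :
  (forall x, measurable (F x)) -> trivIset setT F ->
  (\sum_x mu (F x) = mu (\bigcup_x F x))%E.
Proof.
move=> mF tF.
have -> : \bigcup_x F x = \big[setU/set0]_(i < #|J|) F (enum_val i).
  rewrite -[RHS]bigcup_seq; apply/seteqP; split => w [x _ Fw].
    by exists (enum_rank x); rewrite /= ?mem_index_enum ?enum_rankK.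
  by exists (enum_val x).
rewrite (@measure_bigsetU_ord _ _ _ mu _ xpredT)//.
  by rewrite (reindex (@enum_val J J)) //=; exact/onW_bij/enum_val_bij.
by move=> i j _ _ /(tF _ _ I I) /enum_val_inj.
Qed.

Section LatticeConstructionProbability.
Context {R : realType} {d : nat}.
Variables (A : {fset 'rV[int]_d}) (c delta : R).
Implicit Types (st : @lc_state d) (h : nat -> 'rV[int]_d).

Lemma lc_run_eq h1 h2 i : (forall m, (m < i)%N -> h1 m = h2 m) ->
  lc_run A c delta h1 i = lc_run A c delta h2 i.
Proof.
elim: i => [//|i IH] h12 /=; rewrite IH ?h12// => m mi.
by apply: h12; exact: ltnW.
Qed.

Lemma lc_run_stopped h i j : ~~ lc_running A c delta (lc_run A c delta h i) ->
  lc_run A c delta h (i + j) = lc_run A c delta h i.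
Proof.
move=> nrun; elim: j => [|j IH]; first by rewrite addn0.
by rewrite addnS /= IH /lc_step (negbTE nrun).
Qed.

Lemma lc_run_sub h i : ((lc_run A c delta h i).1 `<=` A)%fset.
Proof.
elim: i => [|i IH] /=; first exact: fsub0set.
rewrite /lc_step; case: ifP => // _; case: ifP => // _ /=.
by rewrite fsubUset IH/=; apply/fsubsetP => k; rewrite !inE => /andP[].
Qed.

(** Translates coverage by the loop into [xi k >= 1], the condition that makes the algorithm well
    defined. *)
Lemma mem_lc_run h i k : (k \in (lc_run A c delta h i).1) =
  (k \in A) && (0 < xi A (lc_run A c delta h i).2 k)%N.
Proof.
elim: i => [|i]/=; first by rewrite /xi big_nil andbF inE.
set st := lc_run A c delta h i => IH.
rewrite /lc_step; case: ifP => // _; case: ifP => // _ /=.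
rewrite !inE IH /xi -cats1 big_cat/= big_seq1/= addn_gt0 lt0b.
by case: (k \in A).
Qed.

Lemma lc_run_moduli h i l : l \in (lc_run A c delta h i).2 -> (0 < l.1)%N.
Proof.
elim: i => [//|i]/=.
set st := lc_run A c delta h i => IH.
rewrite /lc_step; case: ifP => // _; case: ifP => // _ /=.
rewrite mem_rcons inE => /predU1P[->/=|//].
have [_ /andP[pn _]] := lc_primeP A c (size st.2).
exact: prime_gt0.
Qed.

Context {dO : measure_display} {Omega : measurableType dO}.
Variables (P : probability Omega R) (G : nat -> Omega -> 'rV[int]_d).

Definition history (h : nat -> 'rV[int]_d) (i : nat) : set Omega :=
  [set w | forall m, (m < i)%N -> G m w = h m].

Lemma historyS h i v :
  history (fun m => if m == i then v else h m) i.+1 = history h i `&` G i @^-1` [set v].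
Proof.
apply/seteqP; split => w /=.
  move=> H; split => [m mi|]; last by have := H i (ltnSn i); rewrite eqxx.
  by have := H m (ltnW mi); rewrite ltn_eqF.
move=> [H Giv] m; rewrite ltnS leq_eqVlt; case: eqP => [->//|_ /=].
exact: H.
Qed.

Hypothesis mG : forall i v, measurable (G i @^-1` [set v]).

Lemma measurable_history h i : measurable (history h i).
Proof.
have -> : history h i = \bigcap_(m in `I_i) (G m @^-1` [set h m]).
  by apply/seteqP; split => w /=.
exact: bigcap_measurableType.
Qed.

(** There are countably many integer vectors, so conditioning on the last draw gives a countable
    union; hence any property of the state, however defined, is an event. *)
Lemma measurable_lc_run (Q : set (@lc_state d)) i :
  measurable [set w | Q (lc_run A c delta (fun i => G i w) i)].
Proof.
elim: i Q => [|i IH] Q.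
  have [q|q] := pselect (Q (fset0, [::])).
    by rewrite (_ : [set _ | _] = setT)//; apply/seteqP; split.
  by rewrite (_ : [set _ | _] = set0)//; apply/seteqP; split.
rewrite (_ : [set _ | _] = \bigcup_(v : 'rV[int]_d) (G i @^-1` [set v] `&`
    [set w | [set st | Q (lc_step A c delta st v)] (lc_run A c delta (fun i => G i w) i)])).
  apply: countable_bigcupT_measurable => [|v]; first exact: countableP.
  by apply: measurableI => //; exact: IH.
apply/seteqP; split => w /=; first by move=> q; exists (G i w).
by move=> [v _ [/= <-]].
Qed.

Hypothesis c1 : 1 < c.
Hypothesis drawsG : forall i h, lc_running A c delta (lc_run A c delta h i) ->
  let n := lc_modulus A c (lc_run A c delta h i) in
  forall v : 'rV[int]_d, (forall j, 1 <= v 0 j <= n%:Z) ->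
    P (history h i `&` G i @^-1` [set v]) = ((n ^ d)%:R^-1%:E * P (history h i))%E.

Definition covered (i : nat) : set Omega :=
  [set w | (A `<=` (lc_run A c delta (fun i => G i w) i).1)%fset].

Lemma measurable_covered i : measurable (covered i).
Proof. exact: (measurable_lc_run [set st | (A `<=` st.1)%fset]). Qed.

Let mhc h i j : measurable (history h i `&` covered j).
Proof. by apply: measurableI; [exact: measurable_history|exact: measurable_covered]. Qed.

Let pr E : R := fine (P E).

Let prE E : measurable E -> P E = (pr E)%:E.
Proof. by move=> mE; rewrite fineK// fin_num_measure. Qed.

Lemma lc_run_history h i w : history h i w ->
  lc_run A c delta (fun i => G i w) i = lc_run A c delta h i.
Proof. by move=> H; apply: lc_run_eq. Qed.

(** Induction on the number [j] of remaining draws, along the branch of the tree of draws fixed by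
    [h]. The product form replaces a conditional probability and stays meaningful on histories of
    probability 0. *)
Lemma covered_history_ge j i h :
  (1 - potential A c delta j (lc_run A c delta h i)) * pr (history h i)
    <= pr (history h i `&` covered (i + j)).
Proof.
have pr_ge0 E : 0 <= pr E by rewrite fine_ge0.
(* Treats the states that no longer change: either [A] is already covered on the whole history, or
   [V >= 1] and the left-hand side is nonpositive. *)
have stop h' i' (V : R) k : 0 <= V ->
   (~~ (A `<=` (lc_run A c delta h' i').1)%fset -> 1 <= V) ->
   (forall w, history h' i' w ->
      lc_run A c delta (fun i => G i w) k = lc_run A c delta h' i') ->
   (1 - V) * pr (history h' i') <= pr (history h' i' `&` covered k).
  move=> V0 V1 same; have [Asub|nsub] := boolP (A `<=` (lc_run A c delta h' i').1)%fset.
    rewrite (_ : history h' i' `&` covered k = history h' i'); last first.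
      apply/seteqP; split => [w []//|w Hw]; split => //.
      by rewrite /covered/= (same w Hw).
    by rewrite ler_piMl// gerBl.
  apply: (@le_trans _ _ 0) => //; rewrite mulr_le0_ge0//.
  by rewrite subr_le0 V1.
elim: j i h => [|j IH] i h.
  apply: stop; [exact: potential_ge0|exact: potential_ge1_start|].
  by move=> w; rewrite addn0; exact: lc_run_history.
have [run|nrun] := boolP (lc_running A c delta (lc_run A c delta h i)); last first.
  apply: stop; first exact: potential_ge0.
    by move=> ?; apply: potential_ge1_stopped => //; exact: lc_run_sub.
  move=> w Hw; rewrite lc_run_stopped ?(lc_run_history Hw)//.
set n := lc_modulus A c (lc_run A c delta h i).
pose hx (x : {ffun 'I_d -> 'I_n}) m := if m == i then draw_vec x else h m.
have n0 : (0 < n)%N.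
  by have [_ /andP[pn _]] := lc_primeP A c (size (lc_run A c delta h i).2); exact: prime_gt0.
have N0 : 0 < (n ^ d)%:R :> R by rewrite ltr0n expn_gt0 n0.
have prx x : pr (history (hx x) i.+1) = (n ^ d)%:R^-1 * pr (history h i).
  rewrite historyS; apply: EFin_inj; rewrite -prE; last first.
    by rewrite -historyS; exact: measurable_history.
  rewrite EFinM -prE ?drawsG//; first exact: draw_vec_bound.
  exact: measurable_history.
have runx x : lc_run A c delta (hx x) i.+1 =
    lc_step A c delta (lc_run A c delta h i) (draw_vec x).
  rewrite /= {2}/hx eqxx; congr lc_step; apply: lc_run_eq => m mi.
  by rewrite /hx ltn_eqF.
(* The [n^d] extensions of the history by one draw are disjoint; a lower bound needs no more than
   their union. *)
have : \sum_(x : {ffun 'I_d -> 'I_n}) pr (history (hx x) i.+1 `&` covered (i.+1 + j))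
    <= pr (history h i `&` covered (i + j.+1)).
  rewrite -lee_fin -sumEFin -prE//; under eq_bigr do rewrite -prE//.
  rewrite (sum_measure_disjoint P (fun x => mhc (hx x) i.+1 (i.+1 + j))).
    apply: le_measure; rewrite ?inE; first exact: fin_bigcup_measurable.
      exact: mhc.
    move=> w [x _ []]; rewrite historyS addSnnS => -[Hw _] cw.
    by split.
  move=> x y _ _ [w [[+ _] [+ _]]]; rewrite !historyS => -[_ /= Gx] [_ /= Gy].
  by apply: draw_vec_inj; rewrite -Gx -Gy.
apply: le_trans.
have sumle : \sum_(x : {ffun 'I_d -> 'I_n})
     (1 - potential A c delta j (lc_run A c delta (hx x) i.+1)) * pr (history (hx x) i.+1)
   <= \sum_(x : {ffun 'I_d -> 'I_n}) pr (history (hx x) i.+1 `&` covered (i.+1 + j)).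
  by apply: ler_sum => x _; exact: IH.
apply: le_trans sumle.
under eq_bigr do rewrite prx runx.
rewrite -mulr_suml mulrA ler_wpM2r//.
have step := potential_step c1 j (lc_run_sub h i) run.
rewrite sumrB sumr_const card_ffun !card_ord ler_pdivlMr//.
rewrite mulrBl mul1r lerD2l lerN2 mulrC; exact: step.
Qed.

Lemma covered_ge j : #|` A|%:R * c^-1 ^+ lc_Lmax A c delta <= delta ->
  1 - delta - 2 ^+ lc_Lmax A c delta * ((1 + c^-1) / 2) ^+ j <= pr (covered j).
Proof.
move=> bound; have := covered_history_ge j 0 (fun=> 0).
have -> : history (fun=> 0) 0 = setT by apply/seteqP; split.
rewrite setTI add0n [X in _ * X](_ : _ = 1) ?mulr1; last first.
  by rewrite /pr probability_setT.
apply: le_trans; rewrite /potential/= subn0 /uncovered fsetD0.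
have c0 : 0 < c^-1 by rewrite invr_gt0 (lt_trans _ c1).
rewrite opprD addrA lerD//; first by rewrite lerD2l lerN2.
by rewrite lerN2 ler_piMl ?lern1 ?leq_b1// mulr_ge0 ?exprn_ge0 ?divr_ge0 ?addr_ge0 ?ltW.
Qed.

(** Every [covered j] lies in the union; as [j] tends to infinity the term that accounts for an
    unfinished loop disappears. *)
Lemma lc_covers : #|` A|%:R * c^-1 ^+ lc_Lmax A c delta <= delta ->
  ((1 - delta)%:E <= P (\bigcup_i covered i))%E.
Proof.
move=> bound; have mU := bigcupT_measurable _ (fun i => measurable_covered i).
rewrite prE// lee_fin.
have c0 : 0 < c^-1 by rewrite invr_gt0 (lt_trans _ c1).
have q1 : c^-1 < 1 by rewrite invf_lt1// -invr_gt0.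
have lim0 : (fun j => 1 - delta - 2 ^+ lc_Lmax A c delta * ((1 + c^-1) / 2) ^+ j)
    @ \oo --> 1 - delta - 2 ^+ lc_Lmax A c delta * 0.
  apply: cvgB; first exact: cvg_cst.
  apply: cvgMr; apply: cvg_expr.
  by rewrite ger0_norm ?divr_ge0 ?addr_ge0 ?ltW// ltr_pdivrMr// mul1r ltrD2l.
rewrite -[leLHS]subr0 -[X in _ - X](mulr0 (2 ^+ lc_Lmax A c delta)).
rewrite -(cvg_lim _ lim0)//; apply: limr_le; first by apply/cvg_ex; eexists; exact: lim0.
near=> j; apply: (le_trans (covered_ge j bound)).
apply: fine_le; rewrite ?fin_num_measure//.
- exact: measurable_covered.
- by apply: le_measure; rewrite ?inE//; [exact: measurable_covered|exact: bigcup_sup].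
Unshelve. all: by end_near. Qed.

End LatticeConstructionProbability.

(** * Complex-valued integrals *)

Section ComplexIntegral.
Context {R : realType} {dT : measure_display} {T : measurableType dT}.
Variable P : probability T R.
Implicit Types (g : T -> R) (F : T -> R[i]).
Local Notation Re := complex.Re.
Local Notation Im := complex.Im.

(** Stable under sums and products and integrable for every probability, so integrability follows
    from the shape of the integrand. *)
Definition bounded_measurable g :=
  measurable_fun setT g /\ exists B, forall t, `|g t| <= B.

Lemma bounded_measurable_integrable g :
  bounded_measurable g -> P.-integrable setT (EFin \o g).
Proof.
move=> [mg [B gB]]; apply: measurable_bounded_integrable => //.
  by apply: (le_lt_trans (probability_le1 P measurableT)); exact: ltry.
by exists B; split; [exact: num_real|move=> y By t _/=; exact: le_trans (ltW By)].
Qed.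

Lemma bounded_measurable_cst r : bounded_measurable (fun=> r).
Proof. by split => //; exists `|r|. Qed.

Lemma bounded_measurableD g h : bounded_measurable g -> bounded_measurable h ->
  bounded_measurable (fun t => g t + h t).
Proof.
move=> [mg [B gB]] [mh [C hC]]; split; first exact: measurable_funD.
by exists (B + C) => t; apply: le_trans (ler_normD _ _) _; rewrite lerD.
Qed.

Lemma bounded_measurableM g h : bounded_measurable g -> bounded_measurable h ->
  bounded_measurable (fun t => g t * h t).
Proof.
move=> [mg [B gB]] [mh [C hC]]; split; first exact: measurable_funM.
by exists (B * C) => t; rewrite normrM ler_pM.
Qed.

Lemma bounded_measurableN g : bounded_measurable g ->
  bounded_measurable (fun t => - g t).
Proof.
move=> [mg [B gB]]; split; first exact: measurable_funN.
by exists B => t; rewrite normrN.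
Qed.

Lemma bounded_measurableX g n : bounded_measurable g ->
  bounded_measurable (fun t => g t ^+ n).
Proof.
move=> bg; elim: n => [|n IH]; first exact: bounded_measurable_cst.
by under eq_fun do rewrite exprS; exact: bounded_measurableM.
Qed.

Definition cbounded_measurable F :=
  bounded_measurable (fun t => Re (F t)) /\ bounded_measurable (fun t => Im (F t)).

Definition cintegral F : R[i] := ((\int[P]_t Re (F t)) +i* (\int[P]_t Im (F t)))%C.

Lemma complexReD (x y : R[i]) : Re (x + y) = Re x + Re y.
Proof. by case: x y => [a b] [c d]. Qed.

Lemma complexImD (x y : R[i]) : Im (x + y) = Im x + Im y.
Proof. by case: x y => [a b] [c d]. Qed.

Lemma complexReM (x y : R[i]) : Re (x * y) = Re x * Re y - Im x * Im y.
Proof. by case: x y => [a b] [c d]. Qed.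

Lemma complexImM (x y : R[i]) : Im (x * y) = Re x * Im y + Im x * Re y.
Proof. by case: x y => [a b] [c d]. Qed.

Lemma complex_eqP (x y : R[i]) : Re x = Re y -> Im x = Im y -> x = y.
Proof. by case: x y => [a b] [c d] /= -> ->. Qed.

Lemma Re_conjc (x : R[i]) : Re x^*%C = Re x. Proof. by case: x. Qed.
Lemma Im_conjc (x : R[i]) : Im x^*%C = - Im x. Proof. by case: x. Qed.

Lemma sqr_normcE (x : R[i]) : normc x ^+ 2 = Re x ^+ 2 + Im x ^+ 2.
Proof. by case: x => a b /=; rewrite sqr_sqrtr ?addr_ge0 ?sqr_ge0. Qed.

Lemma normc_ge0 (x : R[i]) : 0 <= normc x.
Proof. by case: x => a b /=; rewrite sqrtr_ge0. Qed.

Lemma normRe_le (x : R[i]) : `|Re x| <= normc x.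
Proof.
by rewrite -sqrtr_sqr; case: x => a b /=; rewrite ler_wsqrtr// lerDl sqr_ge0.
Qed.

Lemma normIm_le (x : R[i]) : `|Im x| <= normc x.
Proof.
by rewrite -sqrtr_sqr; case: x => a b /=; rewrite ler_wsqrtr// lerDr sqr_ge0.
Qed.

Lemma mul_conjcE (x : R[i]) : x * x^*%C = (normc x ^+ 2)%:C%C.
Proof.
apply: complex_eqP; rewrite ?complexReM ?complexImM Re_conjc Im_conjc ?sqr_normcE /=; ring.
Qed.

Lemma normc_real (r : R) : normc r%:C%C = `|r|.
Proof. by rewrite /= expr0n addr0 sqrtr_sqr. Qed.

Lemma normc_conjc (x : R[i]) : normc x^*%C = normc x.
Proof. by case: x => a b /=; rewrite sqrrN. Qed.

Lemma normc_sum_le (J : Type) (s : seq J) (Q : pred J) (F : J -> R[i]) :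
  normc (\sum_(j <- s | Q j) F j) <= \sum_(j <- s | Q j) normc (F j).
Proof.
elim/big_ind2 : _ => [|x a y b xa yb|//]; first by rewrite normc0.
by rewrite (le_trans (le_normcD _ _))// lerD.
Qed.

Lemma cbounded_measurable_cst z : cbounded_measurable (fun=> z).
Proof. by split; exact: bounded_measurable_cst. Qed.

Lemma cbounded_measurableD F1 F2 : cbounded_measurable F1 ->
  cbounded_measurable F2 -> cbounded_measurable (fun t => F1 t + F2 t).
Proof.
move=> [r1 i1] [r2 i2]; split.
  by under eq_fun do rewrite complexReD; exact: bounded_measurableD.
by under eq_fun do rewrite complexImD; exact: bounded_measurableD.
Qed.

Lemma cbounded_measurableM F1 F2 : cbounded_measurable F1 ->
  cbounded_measurable F2 -> cbounded_measurable (fun t => F1 t * F2 t).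
Proof.
move=> [r1 i1] [r2 i2]; split.
  under eq_fun do rewrite complexReM; apply: bounded_measurableD.
    exact: bounded_measurableM.
  by apply: bounded_measurableN; exact: bounded_measurableM.
by under eq_fun do rewrite complexImM; apply: bounded_measurableD; exact: bounded_measurableM.
Qed.

Lemma cbounded_measurable_conjc F : cbounded_measurable F ->
  cbounded_measurable (fun t => (F t)^*%C).
Proof.
move=> [r i]; split; first by under eq_fun do rewrite Re_conjc.
by under eq_fun do rewrite Im_conjc; exact: bounded_measurableN.
Qed.

Lemma cbounded_measurable_sum (J : Type) (s : seq J) (F : J -> T -> R[i]) :
  (forall j, cbounded_measurable (F j)) ->
  cbounded_measurable (fun t => \sum_(j <- s) F j t).
Proof.
move=> bF; elim: s => [|j s IH].
  by under eq_fun do rewrite big_nil; exact: cbounded_measurable_cst.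
by under eq_fun do rewrite big_cons; exact: cbounded_measurableD.
Qed.

Lemma cbounded_measurable_real g : bounded_measurable g ->
  cbounded_measurable (fun t => (g t)%:C%C).
Proof. by move=> bg; split => //=; exact: bounded_measurable_cst. Qed.

Lemma cintegralD F1 F2 : cbounded_measurable F1 -> cbounded_measurable F2 ->
  cintegral (fun t => F1 t + F2 t) = cintegral F1 + cintegral F2.
Proof.
move=> [r1 i1] [r2 i2]; apply: complex_eqP; rewrite ?complexReD ?complexImD /=.
  under eq_Rintegral do rewrite complexReD.
  by rewrite RintegralD//; exact: bounded_measurable_integrable.
under eq_Rintegral do rewrite complexImD.
by rewrite RintegralD//; exact: bounded_measurable_integrable.
Qed.

Lemma cintegralZ z F : cbounded_measurable F ->
  cintegral (fun t => z * F t) = z * cintegral F.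
Proof.
move=> [r i].
have iZ a g : bounded_measurable g -> P.-integrable setT (EFin \o (fun t => a * g t)).
  move=> bg; apply: bounded_measurable_integrable; apply: bounded_measurableM => //.
  exact: bounded_measurable_cst.
apply: complex_eqP; rewrite ?complexReM ?complexImM /=.
  under eq_Rintegral do rewrite complexReM.
  rewrite RintegralB//; [|exact: iZ..].
  by rewrite !RintegralZl//; exact: bounded_measurable_integrable.
under eq_Rintegral do rewrite complexImM.
rewrite RintegralD//; [|exact: iZ..].
by rewrite !RintegralZl//; exact: bounded_measurable_integrable.
Qed.

Lemma cintegral_cst z : cintegral (fun=> z) = z.
Proof.
by apply: complex_eqP; rewrite /= Rintegral_cst//= probability_setT mulr1.
Qed.

Lemma cintegral_sum (J : Type) (s : seq J) (F : J -> T -> R[i]) :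
  (forall j, cbounded_measurable (F j)) ->
  cintegral (fun t => \sum_(j <- s) F j t) = \sum_(j <- s) cintegral (F j).
Proof.
move=> bF; elim: s => [|j s IH].
  by under eq_fun do rewrite big_nil; rewrite cintegral_cst big_nil.
under eq_fun do rewrite big_cons.
by rewrite cintegralD//; [rewrite big_cons IH|exact: cbounded_measurable_sum].
Qed.

(** Rotation: with [z] the integral, [|z|^2] is the real part of the integral of [conj z * F], at
    most [|z|] times the integral of [g]. *)
Lemma normc_cintegral_le F g : cbounded_measurable F -> bounded_measurable g ->
  (forall t, normc (F t) <= g t) -> normc (cintegral F) <= \int[P]_t g t.
Proof.
move=> bF bg Fg; set z := cintegral F.
have [z0|z0] := eqVneq (normc z) 0.
  by rewrite z0; apply: Rintegral_ge0 => t _; rewrite (le_trans _ (Fg t))// normc_ge0.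
have zp : 0 < normc z by rewrite lt_neqAle eq_sym z0 normc_ge0.
rewrite -(ler_pM2l zp) -expr2.
have -> : normc z ^+ 2 = Re (cintegral (fun t => z^*%C * F t)).
  by rewrite cintegralZ// mulrC mul_conjcE.
have bzF : cbounded_measurable (fun t => z^*%C * F t).
  by apply: cbounded_measurableM => //; exact: cbounded_measurable_cst.
rewrite -RintegralZl//; last exact: bounded_measurable_integrable.
apply: le_Rintegral => //.
- by apply: bounded_measurable_integrable; case: bzF.
- apply: bounded_measurable_integrable; apply: bounded_measurableM => //.
  exact: bounded_measurable_cst.
- move=> t _; apply: le_trans (le_trans (ler_norm _) (normRe_le _)) _.
  by rewrite normcM normc_conjc ler_wpM2l// ltW.
Qed.

End ComplexIntegral.

(** * Orthogonality of the exponentials *)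

Section Exponentials.
Context {R : realType}.
Local Notation Re := complex.Re.
Local Notation Im := complex.Im.
Local Notation expi2pi := (@expi2pi R).

Lemma expi2piD a b : expi2pi (a + b) = expi2pi a * expi2pi b.
Proof.
by rewrite /Defs.expi2pi mulrDr cosD sinD; apply: complex_eqP; rewrite ?complexReM ?complexImM//= addrC.
Qed.

Lemma expi2pi0 : expi2pi 0 = 1.
Proof. by rewrite /Defs.expi2pi mulr0 cos0 sin0. Qed.

Lemma expi2piN a : expi2pi (- a) = (expi2pi a)^*%C.
Proof. by rewrite /Defs.expi2pi mulrN cosN sinN. Qed.

Lemma normc_expi2pi a : normc (expi2pi a) = 1.
Proof. by rewrite /= cos2Dsin2 sqrtr1. Qed.

Lemma expi2pi_int (z : int) : expi2pi z%:~R = 1.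
Proof.
have e1 : expi2pi 1 = 1.
  by rewrite /Defs.expi2pi mulr1 mulr_natl cos2pi mulr2n sinDpi sinpi oppr0.
have en (n : nat) : expi2pi n%:R = 1.
  elim: n => [|n IH]; first exact: expi2pi0.
  by rewrite -natr1 expi2piD IH e1 mulr1.
case: z => n; first exact: en.
by rewrite NegzE mulrNz expi2piN en conjc1.
Qed.

Lemma freq_dotDr d (k : 'rV[int]_d) (x y : 'rV[R]_d) :
  freq_dot k (x + y) = freq_dot k x + freq_dot k y.
Proof.
by rewrite /freq_dot -big_split; apply: eq_bigr => j _; rewrite mxE mulrDr.
Qed.

Lemma freq_dotDl d (k m : 'rV[int]_d) (x : 'rV[R]_d) :
  freq_dot (k + m) x = freq_dot k x + freq_dot m x.
Proof.
by rewrite /freq_dot -big_split; apply: eq_bigr => j _; rewrite mxE intrD mulrDl.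
Qed.

Lemma freq_dotNl d (k : 'rV[int]_d) (x : 'rV[R]_d) : freq_dot (- k) x = - freq_dot k x.
Proof.
by rewrite /freq_dot -sumrN; apply: eq_bigr => j _; rewrite mxE mulrNz mulNr.
Qed.

Lemma freq_dot_int d (k z : 'rV[int]_d) :
  freq_dot k (map_mx intr z) = (int_dot k z)%:~R :> R.
Proof.
rewrite /freq_dot /int_dot rmorph_sum/=.
by apply: eq_bigr => j _; rewrite mxE intrM.
Qed.

Definition expk d (k : 'rV[int]_d) (x : 'rV[R]_d) : R[i] := expi2pi (freq_dot k x).

Lemma expkDl d (k m : 'rV[int]_d) x : expk (k + m) x = expk k x * expk m x.
Proof. by rewrite /expk freq_dotDl expi2piD. Qed.

Lemma expkDr d (k : 'rV[int]_d) x y : expk k (x + y) = expk k x * expk k y.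
Proof. by rewrite /expk freq_dotDr expi2piD. Qed.

Lemma expkN d (k : 'rV[int]_d) x : expk (- k) x = (expk k x)^*%C.
Proof. by rewrite /expk freq_dotNl expi2piN. Qed.

Lemma expk_int d (k z : 'rV[int]_d) : expk k (map_mx intr z) = 1.
Proof. by rewrite /expk freq_dot_int expi2pi_int. Qed.

Lemma expk0 d x : expk (0 : 'rV[int]_d) x = 1.
Proof.
by rewrite /expk /freq_dot big1 ?expi2pi0// => j _; rewrite mxE mul0r.
Qed.

Lemma normc_expk d (k : 'rV[int]_d) x : normc (expk k x) = 1.
Proof. exact: normc_expi2pi. Qed.

End Exponentials.

Section CubeIntegral.
Context {R : realType}.
Local Notation MR := (measurableTypeR R).
Local Notation U := (uniform_prob (@ltr01 R)).

Lemma measurable_phase d (th : R) (kap : 'I_d -> int) :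
  measurable_fun setT (fun t : d.-tuple MR => th + 2 * pi * \sum_j (kap j)%:~R * tnth t j).
Proof.
apply: measurable_funD => //; apply: measurable_funM => //.
apply: measurable_sum => j; apply: measurable_funM => //; exact: measurable_tnth.
Qed.

(** The summand 1 keeps the integrand nonnegative, as Tonelli's theorem requires later; the free
    phase [th] gives cosine and sine at once. *)
Lemma integral_uniform_cos (th : R) (k : int) :
  (\int[U]_x (1 + cos (th + 2 * pi * (k%:~R * x)))%:E
    = (1 + (k == 0)%:R * cos th)%:E)%E.
Proof.
have ge0 (y : R) : (0 <= (1 + cos y)%:E)%E by rewrite lee_fin -lerBlDl sub0r cos_geN1.
have mc : continuous (fun x : R => 1 + cos (th + 2 * pi * (k%:~R * x)) : R^o).
  move=> x; apply: cvgD; first exact: cvg_cst.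
  apply: (@continuous_comp _ _ _ (fun x : R => th + 2 * pi * (k%:~R * x)) (@cos R)).
    apply: cvgD; first exact: cvg_cst.
    by apply: cvgMr; apply: cvgMr; exact: cvg_id.
  exact: continuous_cos.
rewrite integral_uniform//; last first.
  by apply/measurable_EFinP; exact: continuous_measurable_fun.
rewrite subr0 invr1 mul1e.
have [->|k0] := eqVneq k 0.
  under eq_integral do rewrite mul0r mulr0 addr0.
  by rewrite integral_cst//= lebesgue_measure_itv/= lte01 oppr0 adde0 mule1 mul1r.
have pk0 : 2 * pi * k%:~R != 0 :> R.
  by rewrite !mulf_neq0 ?intr_eq0// gt_eqF// pi_gt0.
pose F (x : R) : R := x + (2 * pi * k%:~R)^-1 * sin (th + 2 * pi * (k%:~R * x)).
have dF (x : R) : is_derive x 1 F (1 + cos (th + 2 * pi * (k%:~R * x))).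
  apply: is_derive_eq.
  rewrite /GRing.scale/=; set C := cos _.
  by rewrite add0r mul1r mulr1 mulrCA mulVf// mulr1.
rewrite (@continuous_FTC2 _ _ F)//.
- rewrite mul0r addr0 -EFinB /F; congr EFin.
  rewrite !mulr0 addr0 mulr1 add0r.
  have -> : sin (th + 2 * pi * k%:~R) = sin th.
    rewrite sinD; have := expi2pi_int (R := R) k; rewrite /expi2pi => -[-> ->].
    by rewrite mulr1 mulr0 addr0.
  by rewrite addrK.
- by apply: continuous_subspaceT.
- split.
  + by move=> x _; have [] := dF x.
  + apply/cvg_at_right_filter/differentiable_continuous/derivable1_diffP.
    by have [] := dF 0.
  + apply/cvg_at_left_filter/differentiable_continuous/derivable1_diffP.
    by have [] := dF 1.
- by move=> x _; rewrite derive1E; have [_ ->] := dF x.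
Qed.

(** Induction on [d] for all phases: the first coordinate is absorbed into [th] before the induction
    hypothesis is applied to the others. *)
Lemma integral_cube_cos d (th : R) (kap : 'I_d -> int) :
  (\int[cube_measure d]_t (1 + cos (th + 2 * pi * \sum_j (kap j)%:~R * tnth t j))%:E
    = (1 + [forall j, kap j == 0]%:R * cos th)%:E)%E.
Proof.
have ge0 (y : R) : (0 <= (1 + cos y)%:E)%E by rewrite lee_fin -lerBlDl sub0r cos_geN1.
have mcos n (f : n.-tuple MR -> R) : measurable_fun setT f ->
    measurable_fun setT (fun t => (1 + cos (f t))%:E).
  move=> mf; apply/measurable_EFinP; apply: measurable_funD => //.
  by apply: measurableT_comp => //; apply: continuous_measurable_fun; exact: continuous_cos.
elim: d th kap => [|d IH] th kap.
  rewrite /= integral_dirac//; last by apply: mcos; exact: measurable_phase.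
  rewrite diracT mul1e big_ord0 mulr0 addr0.
  by rewrite (_ : [forall j, _] = true) ?mul1r//; apply/forallP => -[].
rewrite /cube_measure -/cube_measure ge0_integral_distribution//; last first.
  by apply: mcos; exact: measurable_phase.
rewrite fubini_tonelli1; last by move=> x; exact: ge0.
  2: by apply: measurableT_comp => //; apply: mcos; exact: measurable_phase.
rewrite /fubini_F/=.
transitivity (\int[U]_x (1 + [forall j, kap (lift ord0 j) == 0]%:R *
    cos (th + 2 * pi * ((kap ord0)%:~R * x)))%:E)%E.
  apply: eq_integral => x _.
  rewrite -(IH _ (fun j => kap (lift ord0 j))).
  apply: eq_integral => t _; congr (1 + cos _)%:E.
  rewrite big_ord_recl mulrDr addrA tnth0; congr (_ + _ * _).
  by apply: eq_bigr => j _; rewrite tnthS.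
have -> : [forall j, kap j == 0] = (kap ord0 == 0) && [forall j, kap (lift ord0 j) == 0].
  apply/forallP/andP => [H|[H0 /forallP H] j]; first by split; [|apply/forallP].
  by have [i ->|->] := unliftP ord0 j.
case: [forall j, _]; last first.
  under eq_integral do rewrite mul0r addr0.
  by rewrite integral_cst//= probability_setT andbF mul0r addr0 mule1.
under eq_integral do rewrite mul1r.
by rewrite integral_uniform_cos andbT.
Qed.

End CubeIntegral.

Section TrigonometricPolynomials.
Context {R : realType} {d : nat}.
Local Notation MR := (measurableTypeR R).
Local Notation mu := (@cube_measure R d).
Local Notation cp := (@cube_point R d).
Implicit Types (k m : 'rV[int]_d).
Local Notation Re := complex.Re.
Local Notation Im := complex.Im.

Lemma freq_dot_cube_point k (t : d.-tuple MR) :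
  freq_dot k (cp t) = \sum_j (k 0 j)%:~R * tnth t j.
Proof. by apply: eq_bigr => j _; rewrite mxE. Qed.

Lemma bounded_measurable_cos th k :
  bounded_measurable (fun t : d.-tuple MR => cos (th + 2 * pi * freq_dot k (cp t))).
Proof.
split; last by exists 1 => t; rewrite ler_norml cos_geN1 cos_le1.
apply: measurableT_comp.
  by apply: continuous_measurable_fun; exact: continuous_cos.
under eq_fun do rewrite freq_dot_cube_point; exact: measurable_phase.
Qed.

Lemma Rintegral_cube_cos th k :
  \int[mu]_t cos (th + 2 * pi * freq_dot k (cp t)) = (k == 0)%:R * cos th.
Proof.
apply: (addrI 1).
transitivity (\int[mu]_t (1 + cos (th + 2 * pi * freq_dot k (cp t)))).
  rewrite RintegralD//.
  - by rewrite Rintegral_cst//= probability_setT mulr1.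
  - by apply: bounded_measurable_integrable; exact: bounded_measurable_cst.
  - by apply: bounded_measurable_integrable; exact: bounded_measurable_cos.
rewrite /Rintegral; under eq_integral do rewrite freq_dot_cube_point.
rewrite integral_cube_cos/=; congr (1 + (nat_of_bool _)%:R * _).
apply/forallP/eqP => [H|-> j]; last by rewrite mxE.
by apply/rowP => j; rewrite mxE; apply/eqP.
Qed.

Lemma sin_shift (x : R) : sin x = cos (- (pi / 2) + x).
Proof. by rewrite addrC cosBpihalf. Qed.

Lemma cbounded_measurable_expk k : cbounded_measurable (fun t : d.-tuple MR => expk k (cp t)).
Proof.
split; rewrite /expk /expi2pi /=.
  by under eq_fun do rewrite -[X in cos X]add0r; exact: bounded_measurable_cos.
by under eq_fun do rewrite sin_shift; exact: bounded_measurable_cos.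
Qed.

Lemma cintegral_expk k : cintegral mu (fun t => expk k (cp t)) = (k == 0)%:R.
Proof.
rewrite /cintegral /expk /expi2pi /=; apply: complex_eqP => /=.
  under eq_Rintegral do rewrite -[X in cos X]add0r.
  by rewrite Rintegral_cube_cos cos0 mulr1; case: eqP.
under eq_Rintegral do rewrite sin_shift.
by rewrite Rintegral_cube_cos cosN cos_pihalf mulr0; case: eqP.
Qed.

Definition trig (s : seq 'rV[int]_d) (a : 'rV[int]_d -> R[i]) (x : 'rV[R]_d) : R[i] :=
  \sum_(k <- s) a k * expk k x.

Lemma cbounded_measurable_term (a : R[i]) k :
  cbounded_measurable (fun t : d.-tuple MR => a * expk k (cp t)).
Proof.
apply: cbounded_measurableM; first exact: cbounded_measurable_cst.
exact: cbounded_measurable_expk.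
Qed.

Lemma cbounded_measurable_trig s a :
  cbounded_measurable (fun t : d.-tuple MR => trig s a (cp t)).
Proof. by apply: cbounded_measurable_sum => k; exact: cbounded_measurable_term. Qed.

Lemma cintegral_trig_expk s a m : uniq s ->
  cintegral mu (fun t => trig s a (cp t) * expk (- m) (cp t)) = if m \in s then a m else 0.
Proof.
move=> us.
have -> : (fun t => trig s a (cp t) * expk (- m) (cp t)) =
    fun t => \sum_(k <- s) a k * expk (k - m) (cp t).
  by apply/funext => t; rewrite mulr_suml; apply: eq_bigr => k _; rewrite expkDl mulrA.
rewrite cintegral_sum => [|k]; last exact: cbounded_measurable_term.
rewrite (eq_bigr (fun k => a k * (k == m)%:R)) => [|k _]; last first.
  by rewrite cintegralZ ?cintegral_expk ?subr_eq0//; exact: cbounded_measurable_expk.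
case: ifPn => ms.
  rewrite (big_rem m)//= eqxx mulr1 big1_seq ?addr0// => k /andP[_].
  by rewrite mem_rem_uniq// inE => /andP[/negbTE-> _]; rewrite mulr0.
rewrite big1_seq// => k /andP[_ ks]; case: eqP => [km|]; last by rewrite mulr0.
by rewrite -km ks in ms.
Qed.

Lemma parseval_trig s a : uniq s ->
  (\int[mu]_t (normc (trig s a (cp t)) ^+ 2)%:E = (\sum_(k <- s) normc (a k) ^+ 2)%:E)%E.
Proof.
move=> us.
have bT : cbounded_measurable (fun t : d.-tuple MR => trig s a (cp t) * (trig s a (cp t))^*%C).
  apply: cbounded_measurableM; first exact: cbounded_measurable_trig.
  by apply: cbounded_measurable_conjc; exact: cbounded_measurable_trig.
have -> : (fun t => (normc (trig s a (cp t)) ^+ 2)%:E) =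
   EFin \o (fun t => Re (trig s a (cp t) * (trig s a (cp t))^*%C)).
  by apply/funext => t /=; rewrite mul_conjcE.
rewrite -[LHS]fineK; last first.
  by apply: integrable_fin_num => //; apply: bounded_measurable_integrable; case: bT.
congr EFin.
rewrite -/(Rintegral _ _ _).
transitivity (Re (cintegral mu (fun t => trig s a (cp t) * (trig s a (cp t))^*%C))) => //.
have -> : (fun t => trig s a (cp t) * (trig s a (cp t))^*%C) =
   fun t => \sum_(k <- s) (a k)^*%C * (trig s a (cp t) * expk (- k) (cp t)).
  apply/funext => t; rewrite {2}/trig rmorph_sum mulr_sumr; apply: eq_bigr => k _.
  by rewrite rmorphM expkN mulrCA.
have bk k : cbounded_measurable (fun t : d.-tuple MR => trig s a (cp t) * expk (- k) (cp t)).
  apply: cbounded_measurableM; first exact: cbounded_measurable_trig.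
  exact: cbounded_measurable_expk.
rewrite cintegral_sum => [|k]; last first.
  by apply: cbounded_measurableM => //; exact: cbounded_measurable_cst.
under eq_bigr do rewrite cintegralZ// cintegral_trig_expk//.
rewrite big_seq [in RHS]big_seq.
rewrite (eq_bigr (fun k => (normc (a k) ^+ 2)%:C%C)) => [|k ks]; last first.
  by rewrite ks mulrC mul_conjcE.
by rewrite -rmorph_sum.
Qed.

End TrigonometricPolynomials.

(** * Positive measure of small boxes in the cube *)

Section CubeBox.
Context {R : realType}.
Local Notation MR := (measurableTypeR R).
Local Notation U := (uniform_prob (@ltr01 R)).

Lemma uniform_ball_gt0 (x e : R) : 0 <= x <= 1 -> 0 < e ->
  (0 < U [set y | (`|y - x| < e)%R])%E.
Proof.
move=> /andP[x0 x1] e0.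
(* The point [x] may be an endpoint, so the ball is clipped to [[0,1]], where the density is 1. *)
pose a := Num.max 0 (x - e); pose b := Num.min 1 (x + e).
have ab : a < b by rewrite lt_min !gt_max ltr01 !ltrBlDr; apply/andP; split; lra.
have sub : `]a, b[%classic `<=` [set y | (`|y - x| < e)%R].
  move=> y /=; rewrite in_itv/= /a /b gt_max lt_min => /andP[/andP[_ ?] /andP[_ ?]].
  by rewrite ltr_norml; lra.
have mB : measurable ([set y | (`|y - x| < e)%R] : set MR).
  rewrite (_ : [set y | _] = ball x e); first exact: measurable_ball.
  by apply/seteqP; split => y; rewrite /ball/= distrC.
apply: (@lt_le_trans _ _ (U `]a, b[%classic)); last first.
  by apply: le_measure; rewrite ?inE//; exact: measurable_itv.
rewrite /uniform_prob integral_uniform_pdf//.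
rewrite setIidl; last first.
  move=> y /=; rewrite !in_itv/= /a /b gt_max lt_min => /andP[/andP[? _] /andP[? _]].
  by lra.
rewrite (eq_integral (fun=> 1%E)) => [|y]; last first.
  rewrite inE/= in_itv/= /a /b gt_max lt_min => /andP[/andP[y0 _] /andP[y1 _]].
  by rewrite /uniform_pdf (ltW y0) (ltW y1)/= subr0 invr1.
by rewrite integral_cst//= lebesgue_measure_itv/= lte_fin ab mul1e -EFinB lte_fin subr_gt0.
Qed.

Lemma measurable_box d (x : 'I_d -> R) e :
  measurable [set t : d.-tuple MR | forall j, `|tnth t j - x j| < e].
Proof.
rewrite (_ : [set t | _] = \bigcap_(j in [set: 'I_d]) ((fun t => tnth t j) @^-1` ball (x j) e)).
  apply: fin_bigcap_measurable => // j _; rewrite -[X in measurable X]setTI.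
  by apply: measurable_tnth => //; exact: measurable_ball.
apply/seteqP; split => t /= H j; last by rewrite distrC; exact: H.
by move=> _; rewrite /ball/= distrC; exact: H.
Qed.

Lemma cube_box_gt0 d (x : 'I_d -> R) e : (forall j, 0 <= x j <= 1) -> 0 < e ->
  (0 < cube_measure d [set t : d.-tuple MR | forall j, (`|tnth t j - x j| < e)%R])%E.
Proof.
move=> + e0; elim: d x => [|d IH] x x01.
  rewrite (_ : [set t | _] = setT); last by apply/seteqP; split => // t _ -[].
  by rewrite /= diracT lte01.
set S := [set t | _].
suff : (0 < (U \x cube_measure d)%E (tuple_cons (n:=d) @^-1` S))%E by [].
rewrite {}/S (_ : _ @^-1` _ = [set y | (`|y - x ord0| < e)%R] `*`
   [set t : d.-tuple MR | forall j, (`|tnth t j - x (lift ord0 j)| < e)%R]); last first.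
  apply/seteqP; split => -[y t] /=.
    move=> H; split; first by have := H ord0; rewrite tnth0.
    by move=> j; have := H (lift ord0 j); rewrite tnthS.
  move=> [H0 H] j; have [i ->|->] := unliftP ord0 j; first by rewrite tnthS.
  by rewrite tnth0.
have mB : measurable ([set y | (`|y - x ord0| < e)%R] : set MR).
  rewrite (_ : [set y | _] = ball (x ord0) e); first exact: measurable_ball.
  by apply/seteqP; split => y; rewrite /ball/= distrC.
rewrite product_measure1E//; last exact: measurable_box.
by rewrite mule_gt0//; [exact: uniform_ball_gt0|exact: IH].
Qed.

End CubeBox.

(** * Continuity and periodicity *)

Section ComplexContinuity.
Context {R : realType} {d : nat}.
Local Notation MR := (measurableTypeR R).
Local Notation cp := (@cube_point R d).
Local Notation Re := complex.Re.
Local Notation Im := complex.Im.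
Implicit Types (f : 'rV[R]_d -> R[i]) (g : 'rV[R]_d -> R).

Lemma rV_continuousD (g1 g2 : 'rV[R]_d -> R) :
  continuous g1 -> continuous g2 -> continuous (fun x => g1 x + g2 x).
Proof. by move=> c1 c2 x; apply: (@continuousD _ _ 'rV[R]_d g1 g2 x (c1 x) (c2 x)). Qed.

Lemma rV_continuousM (g1 g2 : 'rV[R]_d -> R) :
  continuous g1 -> continuous g2 -> continuous (fun x => g1 x * g2 x).
Proof. by move=> c1 c2 x; apply: (@continuousM _ 'rV[R]_d g1 g2 x (c1 x) (c2 x)). Qed.

Lemma rV_continuousN g : continuous g -> continuous (fun x => - g x).
Proof. by move=> c x; exact: (@continuousN _ _ 'rV[R]_d g x (c x)). Qed.

Lemma rV_continuous_comp g (h : R -> R) :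
  continuous g -> continuous h -> continuous (fun x => h (g x)).
Proof. by move=> cg ch x; apply: (@continuous_comp 'rV[R]_d R R g h x (cg x) (ch _)). Qed.

Lemma rV_continuous_cst (r : R) : continuous (fun _ : 'rV[R]_d => r).
Proof. exact: cst_continuous. Qed.

Definition ccontinuous f :=
  continuous (fun x => Re (f x)) /\ continuous (fun x => Im (f x)).

Lemma continuous_rVP g : continuous g -> forall (x : 'rV[R]_d) (e : R), 0 < e ->
  exists2 r : R, 0 < r & forall y : 'rV[R]_d, (forall j, `|y 0 j - x 0 j| < r) -> `|g y - g x| < e.
Proof.
move=> cg x e e0.
have /cvgrPdist_lt/(_ e e0)/nbhs_ballP[r r0 H] := cg x.
exists r => // y xy; rewrite distrC; apply: H; split => // i j.
by rewrite ord1 /ball/= distrC.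
Qed.

Lemma rVP_continuous g : (forall (x : 'rV[R]_d) (e : R), 0 < e ->
  exists2 r : R, 0 < r & forall y : 'rV[R]_d, ball x r y -> `|g x - g y| < e) ->
  continuous g.
Proof.
move=> H x A /= /nbhs_ballP[e /= e0 eA].
have [r r0 Hr] := H x e e0.
by apply/nbhs_ballP; exists r => // y /Hr xy; apply: eA.
Qed.

Lemma ccontinuous_of f : continuous (f : 'rV[R]_d -> R[i]^o) -> ccontinuous f.
Proof.
move=> cf.
have near (x : 'rV[R]_d) (e : R) : 0 < e ->
    exists2 r : R, 0 < r & forall y, ball x r y -> normc (f x - f y) < e.
  (* The norm of [R[i]] takes its values in [R[i]], hence the complex radius. *)
  move=> e0; have /cvgrPdist_lt/(_ e%:C%C) := cf x; rewrite ltcR => /(_ e0).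
  move=> /nbhs_ballP[r r0 H]; exists r => // y /H /=.
  by rewrite normc_def ltcR; case: (f x - f y).
split; apply: rVP_continuous => x e e0; have [r r0 H] := near x e e0;
  exists r => // y /H.
  move=> /(le_lt_trans (normRe_le _)).
  by case: (f x) (f y) => [? ?] [? ?].
move=> /(le_lt_trans (normIm_le _)).
by case: (f x) (f y) => [? ?] [? ?].
Qed.

Lemma ccontinuous_cst z : ccontinuous (fun=> z).
Proof. by split; exact: rV_continuous_cst. Qed.

Lemma ccontinuousD f1 f2 : ccontinuous f1 -> ccontinuous f2 ->
  ccontinuous (fun x => f1 x + f2 x).
Proof.
move=> [r1 i1] [r2 i2]; split.
  by under eq_fun do rewrite complexReD; exact: rV_continuousD.
by under eq_fun do rewrite complexImD; exact: rV_continuousD.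
Qed.

Lemma ccontinuousM f1 f2 : ccontinuous f1 -> ccontinuous f2 ->
  ccontinuous (fun x => f1 x * f2 x).
Proof.
move=> [r1 i1] [r2 i2]; split.
  under eq_fun do rewrite complexReM; apply: rV_continuousD; first exact: rV_continuousM.
  by apply: rV_continuousN; exact: rV_continuousM.
by under eq_fun do rewrite complexImM; apply: rV_continuousD; exact: rV_continuousM.
Qed.

Lemma continuous_freq_dot (k : 'rV[int]_d) : continuous (freq_dot k : 'rV[R]_d -> R).
Proof.
rewrite /freq_dot; elim: (index_enum _) => [|j s IH].
  by under eq_fun do rewrite big_nil; exact: rV_continuous_cst.
under eq_fun do rewrite big_cons; apply: rV_continuousD; last exact: IH.
apply: rV_continuousM; first exact: rV_continuous_cst.
by move=> x; exact: coord_continuous.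
Qed.

Lemma ccontinuous_expk (k : 'rV[int]_d) : ccontinuous (expk k).
Proof.
have cphase : continuous (fun x : 'rV[R]_d => 2 * pi * freq_dot k x).
  by apply: rV_continuousM; [exact: rV_continuous_cst|exact: continuous_freq_dot].
split; rewrite /expk /expi2pi/=.
  exact: (rV_continuous_comp cphase (@continuous_cos R)).
exact: (rV_continuous_comp cphase (@continuous_sin R)).
Qed.

Lemma ccontinuous_trig s a : ccontinuous (trig s a).
Proof.
elim: s => [|k s IH].
  by rewrite /trig; under eq_fun do rewrite big_nil; exact: ccontinuous_cst.
rewrite /trig; under eq_fun do rewrite big_cons; apply: ccontinuousD; last exact: IH.
by apply: ccontinuousM; [exact: ccontinuous_cst|exact: ccontinuous_expk].
Qed.

(* [g] is the pointwise limit of its values at the grid points [floor (n x) / n]. *)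
Lemma measurable_continuous_cube g : continuous g ->
  measurable_fun setT (fun t => g (cp t)).
Proof.
move=> cg.
pose grid (n : nat) (t : d.-tuple MR) : 'rV[int]_d :=
  \row_j Num.floor (n.+1%:R * tnth t j : R).
apply: (@measurable_fun_cvg _ _ _ _
  (fun n t => g (\row_j ((grid n t 0 j)%:~R / n.+1%:R)))).
  move=> n _ Y mY; rewrite setTI.
  (* The approximation is constant on each grid cell, and the cells are boxes indexed by integer
     vectors. *)
  rewrite (_ : _ @^-1` _ = \bigcup_(z : 'rV[int]_d)
     ([set t | Y (g (\row_j ((z 0 j)%:~R / n.+1%:R)))] `&`
      \bigcap_(j in [set: 'I_d]) (fun t : d.-tuple MR => n.+1%:R * tnth t j)
         @^-1` `[(z 0 j)%:~R, (z 0 j + 1)%:~R[)); last first.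
    apply/seteqP; split => t /=.
      move=> Yt; exists (grid n t) => //; split => // j _ /=.
      by rewrite in_itv mxE floor_itv.
    move=> [z _ [Yz zt]]; suff -> : grid n t = z by [].
    by apply/rowP => j; rewrite mxE; apply: floor_def; have /= := zt j I; rewrite in_itv.
  apply: countable_bigcupT_measurable => [|z]; first exact: countableP.
  apply: measurableI.
    have [Yz|Yz] := pselect (Y (g (\row_j ((z 0 j)%:~R / n.+1%:R)))).
      by rewrite (_ : [set _ | _] = setT)//; apply/seteqP; split.
    by rewrite (_ : [set _ | _] = set0)//; apply/seteqP; split.
  apply: fin_bigcap_measurable => // j _; rewrite -[X in measurable X]setTI.
  have mj : measurable_fun setT (fun t : d.-tuple MR => n.+1%:R * tnth t j).
    by apply: measurable_funM => //; exact: measurable_tnth.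
  by apply: mj => //; exact: measurable_itv.
move=> t _; apply/cvgrPdist_lt => e e0.
have [r r0 H] := continuous_rVP cg (cp t) e0.
near=> n; rewrite distrC; apply: H => j; rewrite !mxE.
have n0 : 0 < n.+1%:R :> R by [].
set x := tnth t j.
have /andP[fx xf] := floor_itv (n.+1%:R * x).
rewrite -(ltr_pM2l n0) -[X in X * `| _ |](gtr0_norm n0) -normrM mulrBr mulrCA divff ?gt_eqF// mulr1.
have : 1 < n.+1%:R * r.
  rewrite -ltr_pdivrMr// div1r; near: n.
  apply: filterS (nbhs_infty_gtr r^-1) => n /lt_le_trans; apply.
  by rewrite ler_nat.
apply: le_lt_trans; rewrite ler_norml; move: fx xf; rewrite intrD.
by move: (n.+1%:R * x) => y; move: ((Num.floor y)%:~R : R) => z; lra.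
Unshelve. all: by end_near. Qed.

End ComplexContinuity.

Section Periodic.
Context {R : realType} {d : nat}.
Local Notation MR := (measurableTypeR R).
Local Notation mu := (@cube_measure R d).
Local Notation cp := (@cube_point R d).
Local Notation Re := complex.Re.
Local Notation Im := complex.Im.
Implicit Types (f h : 'rV[R]_d -> R[i]) (x y : 'rV[R]_d) (e B eta : R).

Definition cperiodic f := forall x j, f (x + delta_mx 0 j) = f x.

Lemma cperiodic_int f x (z : 'rV[int]_d) : cperiodic f ->
  f (x + map_mx intr z) = f x.
Proof.
move=> pf.
have pn (n : nat) j y : f (y + n%:R *: delta_mx 0 j) = f y.
  elim: n y => [|n IH] y; first by rewrite scale0r addr0.
  by rewrite -natr1 scalerDl scale1r addrA pf.
have pz (n : int) j y : f (y + n%:~R *: delta_mx 0 j) = f y.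
  case: n => n; first exact: pn.
  by rewrite -[LHS](pn n.+1 j) NegzE mulrNz scaleNr subrK.
have -> : map_mx intr z = \sum_(j <- index_enum 'I_d) (z 0 j)%:~R *: delta_mx 0 j :> 'rV[R]_d.
  by rewrite [LHS]row_sum_delta; apply: eq_bigr => j _; rewrite mxE.
elim: (index_enum _) x => [|j s IH] x; first by rewrite big_nil addr0.
by rewrite big_cons addrA IH pz.
Qed.

Lemma cperiodic_frac f x : cperiodic f ->
  exists2 y : 'rV[R]_d, (forall j, 0 <= y 0 j <= 1) & f x = f y.
Proof.
move=> pf; exists (x - map_mx intr (\row_j Num.floor (x 0 j))).
  move=> j; rewrite !mxE.
  by have := floor_itv (x 0 j); rewrite intrD => /andP[? ?]; apply/andP; split; lra.
by rewrite -[RHS](cperiodic_int _ (\row_j Num.floor (x 0 j)) pf) subrK.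
Qed.

Lemma cperiodic_expk (k : 'rV[int]_d) : cperiodic (expk k).
Proof.
move=> x j; have -> : delta_mx 0 j = map_mx intr (delta_mx 0 j : 'rV[int]_d) :> 'rV[R]_d.
  by apply/matrixP => a b; rewrite !mxE; case: (_ && _).
by rewrite expkDr expk_int mulr1.
Qed.

Lemma cperiodic_trig s a : cperiodic (trig s a).
Proof. by move=> x j; apply: eq_bigr => k _; rewrite cperiodic_expk. Qed.

Lemma normc_le_ReIm (z : R[i]) : normc z <= `|Re z| + `|Im z|.
Proof.
rewrite -(ger0_norm (normc_ge0 z)) -ler_sqr ?nnegrE ?addr_ge0//.
rewrite (ger0_norm (normc_ge0 z)) sqr_normcE sqrrD !real_normK ?num_real//.
by rewrite [leRHS]addrAC lerDl mulrn_wge0// mulr_ge0.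
Qed.

Lemma ccontinuous_bounded f : ccontinuous f -> cperiodic f ->
  exists2 B, 0 < B & forall x, normc (f x) <= B.
Proof.
move=> [cr ci] pf.
have bnd (g : 'rV[R]_d -> R) : continuous g ->
    exists B : R, forall x : 'rV[R]_d, (forall j, 0 <= x 0 j <= 1) -> `|g x| <= B.
  move=> cg.
  have cK := @rV_compact _ d (fun=> `[0 : R, 1]%classic) (fun=> @segment_compact R 0 1).
  have cg' : {within [set v : 'rV[R]_d | forall i, `[0 : R, 1]%classic (v ord0 i)], continuous g}.
    exact: (@continuous_subspaceT 'rV[R]_d R _ g cg).
  have /compact_bounded[N [_ HN]] := @continuous_compact 'rV[R]_d R g _ cg' cK.
  exists (N + 1) => x x01; apply: (HN (N + 1)); first by rewrite ltrDl.
  by exists x => // j /=; rewrite in_itv.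
have [B1 H1] := bnd _ cr; have [B2 H2] := bnd _ ci.
exists (`|B1| + `|B2| + 1) => [|x]; first by rewrite ltr_wpDl ?addr_ge0.
have [y y01 ->] := cperiodic_frac x pf.
apply: (le_trans (normc_le_ReIm _)); rewrite -[leLHS]addr0 lerD// lerD//.
  by rewrite (le_trans (H1 y y01)) ?ler_norm.
by rewrite (le_trans (H2 y y01)) ?ler_norm.
Qed.

Lemma ccontinuous_cbounded_measurable f : ccontinuous f -> cperiodic f ->
  cbounded_measurable (fun t : d.-tuple MR => f (cp t)).
Proof.
move=> cf pf; have [B B0 fB] := ccontinuous_bounded cf pf; case: cf => cr ci.
split; (split; last exists B => t).
- exact: (measurable_continuous_cube cr).
- by apply: le_trans (fB (cp t)); exact: normRe_le.
- exact: (measurable_continuous_cube ci).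
- by apply: le_trans (fB (cp t)); exact: normIm_le.
Qed.

Lemma cos2pi_int_shift (t : R) (z : int) : cos (2 * pi * (t - z%:~R)) = cos (2 * pi * t).
Proof.
have := expi2piD t (- z%:~R); rewrite -mulrNz expi2pi_int mulr1.
by rewrite /expi2pi => -[].
Qed.

(* By periodicity it suffices that every [x_j - y_j] be close to an integer. *)
Lemma cperiodic_close f x e : ccontinuous f -> cperiodic f -> 0 < e ->
  exists2 eta : R, 0 < eta &
    forall y : 'rV[R]_d, (forall j, 1 - eta <= cos (2 * pi * (y 0 j - x 0 j))) ->
    normc (f y - f x) <= e.
Proof.
move=> [cr ci] pf e0.
have e20 : 0 < e / 2 by rewrite divr_gt0.
have [r1 r10 H1] := continuous_rVP cr x e20.
have [r2 r20 H2] := continuous_rVP ci x e20.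
(* The bound [1/2] keeps [2 pi r] in [[0, pi]], where the cosine decreases. *)
pose r := Num.min (Num.min r1 r2) 2^-1.
have r0 : 0 < r by rewrite !lt_min r10 r20 invr_gt0/=.
have r12 : r <= 2^-1 by rewrite ge_min lexx orbT.
have pi0 := pi_gt0 R.
have half (w : R) : 0 <= w -> w <= 2^-1 -> 2 * pi * w \in `[0, pi].
  move=> w0 w1; rewrite in_itv/=; apply/andP; split.
    by rewrite !mulr_ge0 ?(ltW pi0).
  by rewrite mulrAC ler_piMl ?(ltW pi0)// mulrC -ler_pdivlMr// div1r.
have cr1 : cos (2 * pi * r) < 1.
  rewrite -[ltRHS]cos0 ltr_cos ?half ?(ltW r0)//; first by rewrite !mulr_gt0.
  by rewrite in_itv/= lexx ltW.
(* Half of the gap, so that [1 - eta] is strictly above [cos (2 pi r)]. *)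
exists ((1 - cos (2 * pi * r)) / 2) => [|y H]; first by rewrite divr_gt0// subr_gt0.
(* Rounding to a nearest integer: each remaining difference is at most [1/2] in absolute value. *)
pose z : 'rV[int]_d := \row_j Num.floor (y 0 j - x 0 j + 2^-1).
have fz : f y = f (y - map_mx intr z).
  by rewrite -[RHS](cperiodic_int _ z pf) subrK.
have close j : `|(y - map_mx intr z) 0 j - x 0 j| < r.
  have := floor_itv (y 0 j - x 0 j + 2^-1); rewrite intrD => /andP[z1 z2].
  have := H j; rewrite -(cos2pi_int_shift (y 0 j - x 0 j) (z 0 j)) !mxE.
  set t := y 0 j - x 0 j - _; rewrite addrAC -/t => Ht.
  have t2 : `|t| <= 2^-1 by rewrite ler_norml /t; move: z1 z2; lra.
  rewrite ltNge; apply/negP => rt.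
  have : cos (2 * pi * t) <= cos (2 * pi * r).
    rewrite -(cos_norm (2 * pi * t)) normrM (gtr0_norm (mulr_gt0 _ pi0))//.
    rewrite le_eqVlt; move: rt; rewrite le_eqVlt => /predU1P[->|rt]; first by rewrite eqxx.
    rewrite ltr_cos ?half ?(ltW r0)// ltr_pM2l ?rt ?orbT// mulr_gt0//.
  move: Ht cr1; set C := cos _; set D := cos _; lra.
rewrite fz; apply: (le_trans (normc_le_ReIm _)).
have Re_sub (a b : R[i]) : Re (a - b) = Re a - Re b by case: a b => [? ?] [? ?].
have Im_sub (a b : R[i]) : Im (a - b) = Im a - Im b by case: a b => [? ?] [? ?].
rewrite Re_sub Im_sub (splitr e) lerD// ltW//.
  by apply: H1 => j; rewrite (lt_le_trans (close j))// !ge_min lexx.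
by apply: H2 => j; rewrite (lt_le_trans (close j))// !ge_min lexx !orbT.
Qed.

End Periodic.

(** * Uniform bounds from Fourier coefficients *)

Section PeakedKernel.
Context {R : realType} {d : nat}.
Local Notation MR := (measurableTypeR R).
Local Notation mu := (@cube_measure R d).
Local Notation cp := (@cube_point R d).
Local Notation Re := complex.Re.
Local Notation Im := complex.Im.
Implicit Types (f h T : 'rV[R]_d -> R[i]) (x y : 'rV[R]_d) (k : 'rV[int]_d).

Definition is_trig T := exists s a, uniq s /\ forall x, T x = trig s a x.

(** Products of trigonometric polynomials repeat frequencies; collecting equal ones restores the
    uniqueness that lets coefficients be read off by integration. *)
Lemma is_trig_list (l : seq (R[i] * 'rV[int]_d)) :
  is_trig (fun x => \sum_(p <- l) p.1 * expk p.2 x).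
Proof.
exists (undup [seq p.2 | p <- l]), (fun k => \sum_(p <- l | p.2 == k) p.1).
split=> [|x]; first exact: undup_uniq.
rewrite /trig; under [RHS]eq_bigr do rewrite mulr_suml big_mkcond/=.
rewrite exchange_big/= big_seq [RHS]big_seq; apply: eq_bigr => p pl.
rewrite -big_mkcond/= (big_rem p.2) ?mem_undup ?map_f//= eqxx.
rewrite big1_seq ?addr0// => k /andP[/eqP ->].
by rewrite mem_rem_uniq ?undup_uniq// inE eqxx.
Qed.

Lemma is_trig_cst (z : R[i]) : is_trig (fun=> z).
Proof.
exists [:: 0], (fun=> z); split=> // x.
by rewrite /trig big_seq1 expk0 mulr1.
Qed.

Lemma is_trigM T1 T2 : is_trig T1 -> is_trig T2 -> is_trig (fun x => T1 x * T2 x).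
Proof.
move=> [s1 [a1 [_ T1E]]] [s2 [a2 [_ T2E]]].
have [s [a [us aE]]] := is_trig_list
  [seq (a1 k1 * a2 k2, k1 + k2) | k1 <- s1, k2 <- s2].
exists s, a; split=> // x; rewrite -aE T1E T2E /trig big_allpairs_dep/= mulr_suml.
apply: eq_bigr => k1 _; rewrite mulr_sumr; apply: eq_bigr => k2 _ /=.
by rewrite expkDl mulrACA.
Qed.

(** [(1 + cos t) / 2] is [1/2 + exp(i t) / 4 + exp(- i t) / 4]. *)
Lemma is_trig_cos x (j : 'I_d) :
  is_trig (fun y => ((1 + cos (2 * pi * (y 0 j - x 0 j))) / 2)%:C%C).
Proof.
pose k : 'rV[int]_d := delta_mx 0 j.
have fk y : freq_dot k y = y 0 j :> R.
  rewrite /freq_dot (bigD1 j)//= mxE !eqxx mul1r big1 ?addr0// => i ij.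
  by rewrite mxE (negbTE ij) mul0r.
have [s [a [us aE]]] := is_trig_list [:: ((2^-1 : R)%:C%C, 0);
  ((4^-1 : R)%:C%C * expi2pi (- x 0 j), k); ((4^-1 : R)%:C%C * expi2pi (x 0 j), - k)].
exists s, a; split=> // y; rewrite -aE !big_cons big_nil/= expk0 mulr1 addr0.
pose t : R := y 0 j - x 0 j.
have E1 : - x 0 j + y 0 j = t by rewrite addrC.
have E2 : x 0 j - y 0 j = - t by rewrite opprB.
rewrite -!mulrA expkN /expk fk -expi2piN -!expi2piD E1 E2 expi2piN /expi2pi.
have key (c s' : R) : ((1 + c) / 2)%:C%C = (2^-1)%:C%C +
    ((4^-1)%:C%C * (c +i* s')%C + (4^-1)%:C%C * ((c +i* s')%C)^*%C).
  by apply: complex_eqP; rewrite !(complexReD,complexImD,complexReM,complexImM)/=; field.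
by rewrite mulrA; exact: key.
Qed.

Lemma fourier_coefE f k : fourier_coef f k = cintegral mu (fun t => f (cp t) * expk (- k) (cp t)).
Proof.
by rewrite /fourier_coef /cube_cintegral /cintegral /expk; congr Complex;
  apply: eq_Rintegral => t _; rewrite freq_dotNl.
Qed.

(** The integral is the sum of [a_k] times the coefficient of [h] at [- k], and each coefficient
    [a_k] of [T] is bounded by the integral of [g]. *)
Lemma cintegral_trigM_le h eps T g :
  cbounded_measurable (fun t : d.-tuple MR => h (cp t)) ->
  (forall s : seq 'rV[int]_d, uniq s -> \sum_(k <- s) normc (fourier_coef h k) <= eps) ->
  is_trig T -> bounded_measurable g -> (forall t, normc (T (cp t)) <= g t) ->
  normc (cintegral mu (fun t => h (cp t) * T (cp t))) <= eps * \int[mu]_t g t.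
Proof.
move=> bh hs [s [a [us TE]]] bg Tg.
have g0 : 0 <= \int[mu]_t g t.
  by apply: Rintegral_ge0 => t _; apply: le_trans (Tg t); exact: normc_ge0.
have bhe k : cbounded_measurable (fun t : d.-tuple MR => h (cp t) * expk k (cp t)).
  by apply: cbounded_measurableM => //; exact: cbounded_measurable_expk.
have -> : (fun t => h (cp t) * T (cp t)) =
    (fun t => \sum_(k <- s) a k * (h (cp t) * expk k (cp t))).
  by apply/funext => t; rewrite TE /trig mulr_sumr; apply: eq_bigr => k _; rewrite mulrCA.
rewrite cintegral_sum => [|k]; last first.
  by apply: cbounded_measurableM => //; exact: cbounded_measurable_cst.
apply: (le_trans (normc_sum_le _ _ _)).
apply: (@le_trans _ _ (\sum_(k <- s) normc (fourier_coef h (- k)) * \int[mu]_t g t)).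
  rewrite big_seq [leRHS]big_seq; apply: ler_sum => k ks.
  rewrite cintegralZ// normcM mulrC fourier_coefE opprK ler_wpM2l ?normc_ge0//.
  have <- : cintegral mu (fun t => trig s a (cp t) * expk (- k) (cp t)) = a k.
    by rewrite cintegral_trig_expk// ks.
  apply: normc_cintegral_le => // [|t].
    by apply: cbounded_measurableM; [exact: cbounded_measurable_trig|exact: cbounded_measurable_expk].
  by rewrite normcM normc_expk mulr1 -TE.
rewrite -mulr_suml ler_wpM2r// -(big_map -%R xpredT (fun k => normc (fourier_coef h k))).
by apply: hs; rewrite map_inj_uniq//; exact: oppr_inj.
Qed.

Definition peak x y : R := \prod_(j < d) ((1 + cos (2 * pi * (y 0 j - x 0 j))) / 2).

Lemma peak_factor (t : R) : 0 <= (1 + cos t) / 2 <= 1.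
Proof. by have := cos_geN1 t; have := cos_le1 t; lra. Qed.

Lemma is_trig_peak x n : is_trig (fun y => (peak x y ^+ n)%:C%C).
Proof.
have tp : is_trig (fun y => (peak x y)%:C%C).
  rewrite /peak; elim: (index_enum _) => [|j s IH].
    by under eq_fun do rewrite big_nil; exact: is_trig_cst.
  under eq_fun do rewrite big_cons rmorphM.
  by apply: is_trigM => //; exact: is_trig_cos.
elim: n => [|n IH]; first by under eq_fun do rewrite expr0; exact: is_trig_cst.
by under eq_fun do rewrite exprS rmorphM; exact: is_trigM.
Qed.

Lemma peak_ge0 x y : 0 <= peak x y.
Proof. by apply: prodr_ge0 => j _; have /andP[] := peak_factor (2 * pi * (y 0 j - x 0 j)). Qed.

Lemma peak_le_factor x y j : peak x y <= (1 + cos (2 * pi * (y 0 j - x 0 j))) / 2.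
Proof.
rewrite /peak (bigD1 j)//= -[leRHS]mulr1.
have /andP[f0 _] := peak_factor (2 * pi * (y 0 j - x 0 j)).
rewrite ler_wpM2l// prodr_ile1// => i _; exact: peak_factor.
Qed.

Lemma bounded_measurable_peak x :
  bounded_measurable (fun t : d.-tuple MR => peak x (cp t)).
Proof.
have [s [a [_ E]]] := is_trig_peak x 1.
have [+ _] := cbounded_measurable_trig (R := R) s a.
by under eq_fun do rewrite -E expr1.
Qed.

(** Weierstrass product inequality. *)
Lemma prod_ge_1Bsum (J : Type) (s : seq J) (c : J -> R) :
  (forall j, 0 <= c j <= 1) ->
  1 - \sum_(j <- s) (1 - c j) <= \prod_(j <- s) c j.
Proof.
move=> c01; elim: s => [|j s IH]; first by rewrite !big_nil subr0.
rewrite !big_cons.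
have p01 : 0 <= \prod_(j <- s) c j <= 1.
  apply/andP; split; first by apply: prodr_ge0 => i _; have /andP[] := c01 i.
  by rewrite prodr_ile1// => i _; exact: c01.
have /andP[cj0 cj1] := c01 j; move: IH p01; set S := \sum_(_ <- _) _; set Q := \prod_(_ <- _) _.
move=> IH /andP[Q0 Q1].
have : 0 <= (1 - c j) * (1 - Q) by rewrite mulr_ge0// subr_ge0.
lra.
Qed.

Lemma peak_near x (r : R) : r < 1 ->
  exists2 e : R, 0 < e & forall y, (forall j, `|y 0 j - x 0 j| < e) -> r <= peak x y.
Proof.
move=> r1.
(* The allowed loss [1 - r] is shared among the [d] factors; [d + 1] keeps the quotient meaningful
   for [d = 0]. *)
have e0 : 0 < (1 - r) / d.+1%:R by rewrite divr_gt0// subr_gt0.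
have /cvgrPdist_lt/(_ _ e0)/nbhs_ballP[u /= u0 Hu] := @continuous_cos R 0.
exists (u / (2 * pi)) => [|y xy]; first by rewrite divr_gt0// mulr_gt0// pi_gt0.
apply: le_trans (prod_ge_1Bsum (index_enum 'I_d) _); last by move=> j; exact: peak_factor.
suff : \sum_j (1 - (1 + cos (2 * pi * (y 0 j - x 0 j))) / 2) <= 1 - r by move: (\sum_j _) => S; lra.
apply: (@le_trans _ _ (\sum_(j < d) (1 - r) / d.+1%:R)).
  apply: ler_sum => j _.
  have := Hu (2 * pi * (y 0 j - x 0 j)).
  rewrite /ball/= sub0r normrN normrM (@gtr0_norm _ (2 * pi)) ?mulr_gt0 ?pi_gt0//.
  have := xy j; rewrite ltr_pdivlMr ?mulr_gt0 ?pi_gt0// mulrC => xyj /(_ xyj).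
  rewrite cos0 => H; have := le_lt_trans (ler_norm _) H.
  have := cos_le1 (2 * pi * (y 0 j - x 0 j)).
  move: (cos _) => C; move: ((1 - r) / _) => E; lra.
rewrite sumr_const card_ord -[_ *+ d]mulr_natr mulrAC ler_pdivrMr//.
by rewrite ler_wpM2l ?subr_ge0 ?(ltW r1)// ler_nat.
Qed.

End PeakedKernel.

Section FourierBound.
Context {R : realType} {d : nat}.
Local Notation MR := (measurableTypeR R).
Local Notation mu := (@cube_measure R d).
Local Notation cp := (@cube_point R d).
Implicit Types (h : 'rV[R]_d -> R[i]) (x y : 'rV[R]_d).

Lemma geometric_dominates (a C q r : R) : 0 < a -> 0 <= q -> q < r ->
  exists n, C * q ^+ n < a * r ^+ n.
Proof.
move=> a0 q0 qr; have r0 : 0 < r by exact: le_lt_trans qr.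
have lim0 : (fun n => C * (q / r) ^+ n) @ \oo --> C * 0.
  apply: cvgMr; apply: cvg_expr.
  by rewrite ger0_norm ?divr_ge0 ?(ltW r0)// ltr_pdivrMr// mul1r.
rewrite mulr0 in lim0; have /cvgrPdist_lt/(_ _ a0)[n _ /(_ n (leqnn n))] := lim0.
rewrite /= sub0r normrN => /(le_lt_trans (ler_norm _)) Hn.
exists n; rewrite -ltr_pdivrMr ?exprn_gt0// -mulrA.
by rewrite -exprVn -exprMn.
Qed.

(** [m] is the measure of a box around [x] on which the peak is at least [r]; it serves all powers
    [n]. *)
Lemma peak_integral_ge x r : 0 <= r < 1 -> (forall j, 0 <= x 0 j <= 1) ->
  exists2 m : R, 0 < m & forall n, r ^+ n * m <= \int[mu]_t peak x (cp t) ^+ n.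
Proof.
move=> /andP[r0 r1] x01; have [e e0 near] := peak_near x r1.
pose D := [set t : d.-tuple MR | forall j, `|tnth t j - x 0 j| < e].
have mD : measurable D by exact: measurable_box.
have muD : mu D \is a fin_num by rewrite fin_num_measure.
exists (fine (mu D)) => [|n].
  by rewrite fine_gt0// (cube_box_gt0 x01 e0)/= ltey_eq muD.
have bI : bounded_measurable (\1_D : d.-tuple MR -> R).
  split; first exact: measurable_indic.
  by exists 1 => t; rewrite indicE; case: (_ \in _); rewrite ?normr1 ?normr0.
have -> : r ^+ n * fine (mu D) = \int[mu]_t (r ^+ n * \1_D t).
  rewrite RintegralZl//; last exact: bounded_measurable_integrable.
  by rewrite /Rintegral integral_indic// setIT.
apply: le_Rintegral => //.
- apply: bounded_measurable_integrable; apply: bounded_measurableM => //.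
  exact: bounded_measurable_cst.
- apply: bounded_measurable_integrable; apply: bounded_measurableX.
  exact: bounded_measurable_peak.
- move=> t _; rewrite indicE; case: (boolP (t \in D)) => [|_]; last first.
    by rewrite mulr0 exprn_ge0// peak_ge0.
  rewrite inE => tD; rewrite mulr1 lerXn2r ?nnegrE ?peak_ge0//.
  by apply: near => j; rewrite mxE; exact: tD.
Qed.

(* Averaging [h] against the powers of the peaked kernel, which are trigonometric
   polynomials, sees only the Fourier coefficients but converges to [h x]. *)
Lemma fourier_sup_bound h eps : ccontinuous h -> cperiodic h ->
  (forall s : seq 'rV[int]_d, uniq s -> \sum_(k <- s) normc (fourier_coef h k) <= eps) ->
  forall x, normc (h x) <= eps.
Proof.
move=> ch ph hs x0; have [x x01 ->] := cperiodic_frac x0 ph.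
rewrite leNgt; apply/negP => lt.
pose e := (normc (h x) - eps) / 2.
have e0 : 0 < e by rewrite divr_gt0// subr_gt0.
have [eta eta0 close] := cperiodic_close x ch ph e0.
have [B B0 hB] := ccontinuous_bounded ch ph.
(* Where some coordinate is not close to [x] modulo 1, its factor, hence the peak, is below
   [1 - eta / 2]. The kernel decays there at rate [q], against the slower rate [(1 + q) / 2]
   guaranteed for its integral. *)
pose q := Num.max (1 - eta / 2) 0.
have q0 : 0 <= q by rewrite le_max lexx orbT.
have q1 : q < 1 by rewrite gt_max ltr01 andbT; lra.
have r01 : 0 <= (1 + q) / 2 < 1 by lra.
have qr : q < (1 + q) / 2 by lra.
have [m m0 Im] := peak_integral_ge r01 x01.
have em0 : 0 < e * m by rewrite mulr_gt0.
(* [2 B] bounds [|h x - h y|] for far [y]. This [n] makes the far contribution smaller than [e * I],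
   whereas [|h x| = eps + 2 e] would force it to be at least [e * I]. *)
have [n] := geometric_dominates (2 * B) em0 q0 qr.
have bK : bounded_measurable (fun t : d.-tuple MR => peak x (cp t) ^+ n).
  by apply: bounded_measurableX; exact: bounded_measurable_peak.
have K0 t : 0 <= peak x (cp t) ^+ n by rewrite exprn_ge0// peak_ge0.
have bh := ccontinuous_cbounded_measurable ch ph.
set I := \int[mu]_t peak x (cp t) ^+ n.
have eI : e * ((1 + q) / 2) ^+ n * m <= e * I by rewrite -mulrA ler_pM2l// Im.
have bKc := cbounded_measurable_real bK.
have b1 : cbounded_measurable (fun t => h (cp t) * (peak x (cp t) ^+ n)%:C%C).
  exact: cbounded_measurableM.
have b2' : cbounded_measurable (fun t : d.-tuple MR => h x - h (cp t)).
  under eq_fun do rewrite -[- h _]mulN1r.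
  apply: cbounded_measurableD; first exact: cbounded_measurable_cst.
  by apply: cbounded_measurableM => //; exact: cbounded_measurable_cst.
have b2 : cbounded_measurable (fun t => (h x - h (cp t)) * (peak x (cp t) ^+ n)%:C%C).
  exact: cbounded_measurableM.
have split : h x * I%:C%C = cintegral mu (fun t => h (cp t) * (peak x (cp t) ^+ n)%:C%C)
    + cintegral mu (fun t => (h x - h (cp t)) * (peak x (cp t) ^+ n)%:C%C).
  rewrite -cintegralD//.
  have -> : I%:C%C = cintegral mu (fun t => (peak x (cp t) ^+ n)%:C%C).
    by apply: complex_eqP; rewrite //= Rintegral_cst ?mul0r.
  rewrite -cintegralZ//; congr cintegral; apply/funext => t.
  by rewrite -mulrDl addrC subrK.
have I0 : 0 <= I by apply: Rintegral_ge0.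
have le1 : normc (cintegral mu (fun t => h (cp t) * (peak x (cp t) ^+ n)%:C%C)) <= eps * I.
  apply: (cintegral_trigM_le bh hs (is_trig_peak x n) bK) => t.
  by rewrite normc_real ger0_norm.
have le2 : normc (cintegral mu (fun t => (h x - h (cp t)) * (peak x (cp t) ^+ n)%:C%C))
    <= e * I + 2 * B * q ^+ n.
  have -> : e * I + 2 * B * q ^+ n = \int[mu]_t (e * peak x (cp t) ^+ n + 2 * B * q ^+ n).
    rewrite RintegralD//.
    - rewrite RintegralZl//; last exact: bounded_measurable_integrable.
      by rewrite Rintegral_cst//= probability_setT mulr1.
    - apply: bounded_measurable_integrable; apply: bounded_measurableM => //.
      exact: bounded_measurable_cst.
    - by apply: bounded_measurable_integrable; exact: bounded_measurable_cst.
  apply: normc_cintegral_le => //.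
    apply: bounded_measurableD; last exact: bounded_measurable_cst.
    by apply: bounded_measurableM => //; exact: bounded_measurable_cst.
  move=> t; rewrite normcM normc_real (ger0_norm (K0 t)).
  have [H|/existsNP[j /negP nj]] := pselect (forall j, 1 - eta <= cos (2 * pi * (cp t 0 j - x 0 j))).
    have := close _ H; rewrite -normcN opprB => le.
    by rewrite -[leLHS]addr0 lerD ?ler_wpM2r// mulr_ge0 ?exprn_ge0// mulr_ge0// ltW.
  rewrite -[leLHS]add0r lerD ?(mulr_ge0 (ltW e0) (K0 t))//.
  apply: ler_pM; rewrite ?normc_ge0//.
    rewrite (le_trans (le_normcD _ _))// normcN mulr_natl mulr2n lerD//.
  rewrite lerXn2r ?nnegrE ?peak_ge0// (le_trans (peak_le_factor x _ j))//.
  rewrite /q le_max; apply/orP; left; move: nj; rewrite -ltNge; move: (cos _) => C; lra.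
have : normc (h x) * I <= (eps + e) * I + 2 * B * q ^+ n.
  rewrite -[I in _ * I <= _](ger0_norm I0) -normc_real -normcM split.
  rewrite (le_trans (le_normcD _ _))// mulrDl -addrA lerD//.
have -> : normc (h x) = eps + e + e by rewrite /e; lra.
rewrite (mulrDl (eps + e)) lerD2l => le; apply/negP; rewrite -leNgt mulrAC.
exact: le_trans eI le.
Qed.

End FourierBound.

(** * Fourier coefficients in the Korobov space *)

Section KorobovSummability.
Context {R : realType}.

(** Integral test: the right-hand side is the integral of [t^(-s)] over [[i+1, i+2]]. After division
    by [m^(1-s)] the claim follows from [exp y >= 1 + y] and [ln (1 - u) <= - u]. *)
Lemma inv_powR_le_telescope (s : R) (i : nat) : 1 < s ->
  (i.+2%:R `^ s)^-1 <=
    (s - 1)^-1 * (i.+1%:R `^ (1 - s) - i.+2%:R `^ (1 - s)).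
Proof.
move=> s1; have b0 : 0 < s - 1 by rewrite subr_gt0.
set m : R := i.+2%:R; have m0 : 0 < m by rewrite /m ltr0n.
have -> : i.+1%:R = m * (1 - m^-1) :> R.
  by rewrite mulrBr mulr1 mulfV ?gt_eqF// /m -[i.+2%:R]natr1 addrK.
have m1 : m^-1 < 1 by rewrite invf_lt1// /m ltr1n.
have u0 : 0 < 1 - m^-1 by rewrite subr_gt0.
rewrite powRM ?(ltW m0) ?(ltW u0)// -[X in _ <= _ * (_ - X)]mulr1 -mulrBr.
have -> : (m `^ s)^-1 = m `^ (1 - s) * m^-1.
  have -> : (m `^ s)^-1 = m `^ ((1 - s) - 1) by rewrite -powRN; congr powR; ring.
  by rewrite (@powRD _ m (1 - s) (-1)) ?(gt_eqF m0) ?implybT// powR_inv1 ?(ltW m0).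
rewrite mulrCA ler_pM2l ?powR_gt0// ler_pdivlMl//.
rewrite /powR gt_eqF//.
have := expR_ge1Dx ((1 - s) * ln (1 - m^-1)).
have := le_ln1Dx (x := - m^-1); rewrite ltrN2 m1 => /(_ isT) lnle.
have : (s - 1) * m^-1 <= (1 - s) * ln (1 - m^-1).
  by rewrite -(opprB s) mulNr -mulrN ler_pM2l// lerNr.
set X := (1 - s) * ln _; set Y := (s - 1) * m^-1; move: (expR X) lnle => E _; lra.
Qed.

Lemma sum_inv_powR_le (s : R) n : 1 < s ->
  \sum_(i < n) (i.+1%:R `^ s)^-1 <= 1 + (s - 1)^-1.
Proof.
move=> s1; have b0 : 0 < s - 1 by rewrite subr_gt0.
case: n => [|n]; first by rewrite big_ord0 addr_ge0// invr_ge0 ltW.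
rewrite big_ord_recl powR1 invr1 lerD2l.
have : \sum_(i < n) (i.+2%:R `^ s)^-1 <= (s - 1)^-1 * (1 - n.+1%:R `^ (1 - s)).
  elim: n => [|n IH]; first by rewrite big_ord0 powR1 subrr mulr0.
  rewrite big_ord_recr/=; apply: le_trans (lerD IH (inv_powR_le_telescope n s1)) _.
  by rewrite -mulrDr addrA subrK.
move=> /le_trans; apply; rewrite -[leRHS]mulr1 ler_pM2l ?invr_gt0//.
Qed.

(** The product over the coordinates of [k] is [r(k)^(-2)] for unit weights; the value 1 at 0 stands
    for a coordinate outside the support. *)
Definition int_weight (alpha : R) (z : int) : R :=
  if z == 0 then 1 else ((`|z|%:~R `^ alpha) ^+ 2)^-1.

Lemma int_weight_ge0 alpha z : 0 <= int_weight alpha z.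
Proof. by rewrite /int_weight; case: ifP => _ //; rewrite invr_ge0 exprn_ge0 ?powR_ge0. Qed.

Lemma sum_int_weight_le alpha (N : nat) : 2^-1 < alpha ->
  \sum_(i < (N + N).+1) int_weight alpha (i%:Z - N%:Z)
    <= 1 + 2 * (1 + (2 * alpha - 1)^-1).
Proof.
move=> a2; have s1 : 1 < 2 * alpha by lra.
have wS n : int_weight alpha n.+1 = (n.+1%:R `^ (2 * alpha))^-1.
  rewrite /int_weight/= ger0_norm// -powR_mulrn ?powR_ge0// -powRrM mulrC.
  by [].
have -> : \sum_(i < (N + N).+1) int_weight alpha (i%:Z - N%:Z)
    = 1 + 2 * \sum_(i < N) (i.+1%:R `^ (2 * alpha))^-1.
  elim: N => [|N IH].
    by rewrite big_ord0 mulr0 addr0 big_ord_recl big_ord0 addr0 /int_weight subrr eqxx.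
  rewrite addSn addnS big_ord_recl big_ord_recr/=.
  have -> : \sum_(i < (N + N).+1) int_weight alpha ((bump 0 i)%:Z - N.+1%:Z)
     = \sum_(i < (N + N).+1) int_weight alpha (i%:Z - N%:Z).
    by apply: eq_bigr => i _; congr int_weight; rewrite /bump/=; lia.
  rewrite IH big_ord_recr/= -wS.
  have -> : int_weight alpha (0%N%:Z - N.+1%:Z) = int_weight alpha N.+1.
    by rewrite /int_weight sub0r oppr_eq0 normrN.
  have -> : int_weight alpha ((bump 0 (N + N).+1)%:Z - N.+1%:Z) = int_weight alpha N.+1.
    by congr int_weight; rewrite /bump/=; lia.
  by ring.
by rewrite lerD2l ler_pM2l// sum_inv_powR_le.
Qed.

(** A finite list lies in some box [{-N, ..., N}^d], over which the sum of products factors into a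
    [d]-th power. *)
Lemma sum_prod_int_weight_le d alpha (s : seq 'rV[int]_d) : 2^-1 < alpha -> uniq s ->
  \sum_(k <- s) \prod_j int_weight alpha (k 0 j)
    <= (1 + 2 * (1 + (2 * alpha - 1)^-1)) ^+ d.
Proof.
move=> a2 us; set Z := 1 + _.
have [N HN] : exists N : nat, forall k j, k \in s -> (`|k 0%R j| <= N)%N.
  exists (\sum_(k <- s) \sum_j `|k 0%R j|)%N => k j ks.
  by rewrite (big_rem k)//= (bigD1 j)//= -addnA leq_addr.
pose F (k : 'rV[int]_d) : {ffun 'I_d -> 'I_(N + N).+1} := [ffun j => inord `|(k 0%R j + N%:Z)%R|%N].
pose w (f : {ffun 'I_d -> 'I_(N + N).+1}) := \prod_j int_weight alpha ((f j)%:Z - N%:Z).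
have FE k j : k \in s -> (F k j)%:Z - N%:Z = k 0 j.
  move=> ks; have := HN k j ks; rewrite ffunE; move: (k 0 j) => z zN.
  by rewrite inordK; lia.
have uF : uniq (map F s).
  rewrite map_inj_in_uniq// => k m ks ms /ffunP km; apply/rowP => j.
  by rewrite -(FE k j ks) -(FE m j ms) km.
have -> : \sum_(k <- s) \prod_j int_weight alpha (k 0 j) = \sum_(f <- map F s) w f.
  rewrite big_map big_seq [RHS]big_seq; apply: eq_bigr => k ks.
  by apply: eq_bigr => j _; rewrite FE.
rewrite big_uniq//=.
apply: (@le_trans _ _ (\sum_f w f)).
  rewrite [leRHS](bigID (mem (map F s)))/= lerDl sumr_ge0// => f _.
  by rewrite prodr_ge0// => j _; exact: int_weight_ge0.
rewrite /w -(bigA_distr_bigA (fun _ (i : 'I_(N + N).+1) => int_weight alpha (i%:Z - N%:Z)))/=.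
rewrite prodr_const card_ord lerXn2r ?nnegrE ?sum_int_weight_le//.
  by rewrite sumr_ge0// => i _; exact: int_weight_ge0.
by rewrite /Z addr_ge0 ?mulr_ge0 ?addr_ge0 ?invr_ge0//; lra.
Qed.

End KorobovSummability.

Section KorobovFunctions.
Context {R : realType} {d : nat}.
Local Notation MR := (measurableTypeR R).
Local Notation mu := (@cube_measure R d).
Local Notation cp := (@cube_point R d).
Variables (alpha : R) (gamma : {fset nat} -> R) (M : R).
Hypotheses (alpha2 : 2^-1 < alpha) (gamma0 : forall u, 0 <= gamma u).
Implicit Types (f : 'rV[R]_d -> R[i]) (x y : 'rV[R]_d) (k : 'rV[int]_d) (s : seq 'rV[int]_d).

Lemma mem_korobov_ball k :
  (k \in korobov_ball alpha gamma M) = (korobov_r alpha gamma k <= M%:E)%E.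
Proof.
have a0 : 0 < alpha by apply: lt_trans alpha2; rewrite invr_gt0.
rewrite /korobov_ball in_fset_set; last exact: korobov_ball_finite.
by apply/idP/idP; rewrite inE.
Qed.

(* Equal to [0] when [gamma (supp k) = 0], where [korobov_r] is infinite. *)
Definition korobov_weight k : R :=
  (gamma (supp k))^-1 * \prod_(j < d | k 0 j != 0) (`|k 0 j|%:~R `^ alpha).

Variable f : 'rV[R]_d -> R[i].
Hypotheses (fK : in_korobov alpha gamma f) (f1 : (korobov_norm alpha gamma f <= 1)%E).

Lemma korobov_sum_le1 s : uniq s ->
  \sum_(k <- s) korobov_weight k ^+ 2 * normc (fourier_coef f k) ^+ 2 <= 1.
Proof.
move=> us; pose t := [seq k <- s | gamma (supp k) != 0].
have -> : \sum_(k <- s) korobov_weight k ^+ 2 * normc (fourier_coef f k) ^+ 2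
    = \sum_(k <- t) korobov_weight k ^+ 2 * normc (fourier_coef f k) ^+ 2.
  rewrite big_filter [RHS]big_mkcond/=; apply: eq_bigr => k _.
  by case: eqP => //= g0; rewrite /korobov_weight g0 invr0 mul0r expr0n mul0r.
move: f1; rewrite /korobov_norm -[X in (_ <= X)%E](_ : sqrte 1 = 1%E); last by rewrite /= sqrtr1.
rewrite lee_sqrt// => H; rewrite -lee_fin; apply: le_trans H.
apply: esum_ge; exists [set` t].
  by split; [exact: finite_seq|move=> k /=; rewrite mem_filter => /andP[]].
rewrite -fsbig_seq ?filter_uniq// -sumEFin big_seq [leRHS]big_seq.
apply: lee_sum => k; rewrite mem_filter => /andP[gk _].
by rewrite /korobov_r (negbTE gk) -EFin_expe -EFinM.
Qed.

(** Outside the ball either the weight exceeds [M] or the coefficient is 0 because [gamma] vanishes;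
    this is the source of [1/M] in the error bound. *)
Lemma korobov_sum_tail s : 1 <= M -> uniq s ->
  (forall k, k \in s -> k \notin korobov_ball alpha gamma M) ->
  \sum_(k <- s) normc (fourier_coef f k) ^+ 2 <= (M ^+ 2)^-1.
Proof.
move=> M1 us sA; have M0 : 0 < M by exact: lt_le_trans M1.
rewrite -[leRHS]mulr1 ler_pdivlMl ?exprn_gt0// mulr_sumr.
apply: le_trans (korobov_sum_le1 us).
rewrite big_seq [leRHS]big_seq; apply: ler_sum => k /sA.
rewrite mem_korobov_ball /korobov_r; case: eqP => [g0 _|_].
  by have [_ _ /(_ k g0) -> _] := fK; rewrite normc0 expr0n !mulr0.
rewrite -ltNge lte_fin => Mk.
by rewrite ler_wpM2r ?sqr_ge0// lerXn2r ?nnegrE ?(ltW M0)// ltW// (lt_trans M0).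
Qed.

(** Supports are subsets of a set of [d] coordinates, so the sum of [gamma] over all of these
    subsets is a bound. *)
Lemma gamma_supp_bound : exists2 Gam, 0 <= Gam & forall k, gamma (supp k) <= Gam.
Proof.
pose F (B : {set 'I_d}) : {fset nat} := [fset nat_of_ord j | j : 'I_d & j \in B]%fset.
exists (\sum_(B : {set 'I_d}) gamma (F B)) => [|k]; first exact: sumr_ge0.
have -> : supp k = F (finset (fun j => k 0 j != 0)).
  apply/fsetP => i; apply/imfsetP/imfsetP => -[l /= lP ->]; exists l => //=;
    by move: lP; rewrite !inE.
by rewrite (bigD1 (finset (fun j => k 0 j != 0)))//= lerDl sumr_ge0.
Qed.

(** Termwise [2 |a| <= w^2 |a|^2 + w^(-2)] with [w] the Korobov weight: the first terms sum to at
    most 1 by the norm, the second to a finite bound because [2 alpha > 1]. *)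
Lemma korobov_abs_summable :
  exists C : R, forall s, uniq s -> \sum_(k <- s) normc (fourier_coef f k) <= C.
Proof.
have [Gam Gam0 GamP] := gamma_supp_bound.
exists (2^-1 * (1 + Gam ^+ 2 * (1 + 2 * (1 + (2 * alpha - 1)^-1)) ^+ d)) => s us.
apply: (@le_trans _ _ (2^-1 * \sum_(k <- s)
   (korobov_weight k ^+ 2 * normc (fourier_coef f k) ^+ 2
    + Gam ^+ 2 * \prod_j int_weight alpha (k 0 j)))); last first.
  rewrite ler_pM2l ?invr_gt0// big_split/= lerD ?korobov_sum_le1// -mulr_sumr.
  by rewrite ler_wpM2l ?sqr_ge0// sum_prod_int_weight_le.
rewrite mulr_sumr; apply: ler_sum => k _.
have [g0|g0] := eqVneq (gamma (supp k)) 0.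
  have [_ _ /(_ k g0) -> _] := fK; rewrite normc0 expr0n mulr0 add0r.
  by rewrite mulr_ge0// mulr_ge0 ?sqr_ge0// prodr_ge0// => j _; exact: int_weight_ge0.
have gk : 0 < gamma (supp k) by rewrite lt_neqAle eq_sym g0 gamma0.
pose p := \prod_(j < d | k 0 j != 0) (`|k 0 j|%:~R `^ alpha).
have p0 : 0 < p.
  by apply: prodr_gt0 => j kj; rewrite powR_gt0// ltr0z normr_gt0.
have w0 : 0 < korobov_weight k by rewrite mulr_gt0 ?invr_gt0.
have -> : \prod_j int_weight alpha (k 0 j) = (p ^+ 2)^-1.
  rewrite /p -prodrXl -prodfV [RHS]big_mkcond/=; apply: eq_bigr => j _.
  by rewrite /int_weight; case: eqP.
have le1 : (korobov_weight k ^+ 2)^-1 <= Gam ^+ 2 * (p ^+ 2)^-1.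
  rewrite /korobov_weight -/p exprMn invfM exprVn invrK ler_wpM2r ?invr_ge0 ?sqr_ge0//.
  by rewrite lerXn2r ?nnegrE.
have : 0 <= (korobov_weight k * normc (fourier_coef f k) - (korobov_weight k)^-1) ^+ 2 by exact: sqr_ge0.
move: le1; rewrite -exprVn; move: (Gam ^+ 2 * _) => Q.
rewrite sqrrB -!exprMn.
have -> : korobov_weight k * normc (fourier_coef f k) / korobov_weight k = normc (fourier_coef f k).
  by rewrite mulrAC mulfV ?gt_eqF// mul1r.
by move: (_^-1 ^+ 2) => b; move: (_ ^+ 2) => a; move: (normc _) => n; lra.
Qed.

(** Take [s] whose absolute coefficient sum is within [e] of the supremum over finite lists: any
    disjoint list then adds at most [e], so [fourier_sup_bound] applies to the remainder. *)
Lemma korobov_uniform_approx (A : {fset 'rV[int]_d}) e : 0 < e ->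
  exists s, [/\ uniq s, {subset A <= s} &
    forall x, normc (f x - trig s (fourier_coef f) x) <= e].
Proof.
move=> e0; have [C HC] := korobov_abs_summable.
pose S := [set v | exists2 s, uniq s & v = \sum_(k <- s) normc (fourier_coef f k)].
have hS : has_sup S.
  by split; [exists 0, [::] => //; rewrite big_nil|exists C => _ [s us ->]; exact: HC].
have [_ [s us ->] ls] := sup_adherent e0 hS.
have Ssup t : uniq t -> \sum_(k <- t) normc (fourier_coef f k) <= sup S.
  by move=> ut; apply: sup_upper_bound => //; exists t.
exists (undup (enum_fset A ++ s)); split; first exact: undup_uniq.
  by move=> k kA; rewrite mem_undup mem_cat kA.
set s' := undup _.
have us' : uniq s' by exact: undup_uniq.
have [cf pf _ _] := fK.
have cf' := ccontinuous_of cf.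
pose h x := f x - trig s' (fourier_coef f) x.
have hE : h = fun x => f x + (- 1) * trig s' (fourier_coef f) x.
  by apply/funext => x; rewrite mulN1r.
have ch : ccontinuous h.
  rewrite hE; apply: ccontinuousD => //.
  by apply: ccontinuousM; [exact: ccontinuous_cst|exact: ccontinuous_trig].
have ph : cperiodic h by move=> x j; rewrite /h pf cperiodic_trig.
apply: (fourier_sup_bound ch ph) => t ut.
have hc k : fourier_coef h k = if k \in s' then 0 else fourier_coef f k.
  have b1 : cbounded_measurable (fun u : d.-tuple MR => f (cp u) * expk (- k) (cp u)).
    apply: cbounded_measurableM; last exact: cbounded_measurable_expk.
    exact: ccontinuous_cbounded_measurable.
  have b2 : cbounded_measurable (fun u : d.-tuple MR => trig s' (fourier_coef f) (cp u) * expk (- k) (cp u)).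
    apply: cbounded_measurableM; last exact: cbounded_measurable_expk.
    exact: cbounded_measurable_trig.
  rewrite fourier_coefE hE.
  under eq_fun do rewrite mulrDl -mulrA.
  rewrite cintegralD//; last by apply: cbounded_measurableM => //; exact: cbounded_measurable_cst.
  rewrite cintegralZ// cintegral_trig_expk// -fourier_coefE.
  by case: ifP => _; rewrite mulN1r ?subrr// oppr0 addr0.
have -> : \sum_(k <- t) normc (fourier_coef h k)
    = \sum_(k <- [seq k <- t | k \notin s']) normc (fourier_coef f k).
  rewrite big_filter [RHS]big_mkcond; apply: eq_bigr => k _; rewrite hc.
  by case: (k \in s'); rewrite ?normc0.
have := Ssup (s ++ [seq k <- t | k \notin s']).
rewrite cat_uniq us filter_uniq// andbT big_cat/= => /(_ _)/wrap[].
  apply/hasPn => k; rewrite mem_filter mem_undup mem_cat negb_or -andbA.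
  by case/and3P.
by move: ls; move: (\sum_(k <- s) _) => a; lra.
Qed.

End KorobovFunctions.

(** * Exactness and aliasing of lattice rules *)

Section LatticeRule.
Context {R : realType} {d : nat}.
Local Notation MR := (measurableTypeR R).
Local Notation mu := (@cube_measure R d).
Local Notation cp := (@cube_point R d).
Local Notation Re := complex.Re.
Implicit Types (k m z g : 'rV[int]_d) (A : {fset 'rV[int]_d}) (a : 'rV[int]_d -> R[i]).

Lemma expi2pi_eq1 (x : R) : expi2pi x = 1 -> exists z : int, x = z%:~R.
Proof.
move=> x1; exists (Num.floor x); apply/eqP; rewrite -subr_eq0; set u := x - _.
have /andP[z1 z2] := floor_itv x; rewrite intrD in z2.
have u0 : 0 <= u by rewrite subr_ge0.
have u1 : u < 1 by rewrite /u; lra.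
have pi0 := pi_gt0 R.
have cu : cos (2 * pi * u) = 1 by move: x1; rewrite cos2pi_int_shift => -[].
have half (w : R) : 0 <= w -> w <= 2^-1 -> 2 * pi * w \in `[0, pi].
  move=> w0 w1; rewrite in_itv/=; apply/andP; split.
    by rewrite !mulr_ge0 ?(ltW pi0).
  by rewrite mulrAC ler_piMl ?(ltW pi0)// mulrC -ler_pdivlMr// div1r.
have key (w : R) : 0 <= w -> w <= 2^-1 -> cos (2 * pi * w) = 1 -> w = 0.
  move=> w0 w1; rewrite -[RHS]cos0 => /cos_inj; rewrite half// in_itv/= lexx (ltW pi0).
  by move=> /(_ isT isT)/eqP; rewrite mulf_eq0 gt_eqF ?mulr_gt0//= => /eqP.
(* The cosine is injective only on [[0, pi]], so [u > 1/2] is reflected to [1 - u], whose vanishing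
   contradicts [u < 1]. *)
have [le|lt] := lerP u 2^-1; first by rewrite (key u).
have : cos (2 * pi * (1 - u)) = 1.
  have := cos2pi_int_shift (1 - u) 1; rewrite -{1}[1%:~R]/(1 : R) => <-.
  by rewrite addrAC subrr sub0r mulrN cosN.
by move=> /key; move=> /(_ _ _)/wrap[]; rewrite ?subr_ge0 ?(ltW u1)//; lra.
Qed.

Lemma expk_frac z (y : 'I_d -> R) : expk z (\row_j Defs.frac (y j)) = expk z (\row_j y j).
Proof.
rewrite -[LHS]mulr1 -(expk_int (R := R) z (\row_j Num.floor (y j))) -expkDr.
by congr expk; apply/rowP => j; rewrite !mxE /Defs.frac subrK.
Qed.

Lemma expk_lattice_point n z g (i : nat) : (0 < n)%N ->
  expk z (lattice_point n g i) = expi2pi ((int_dot z g)%:~R / n%:R : R) ^+ i.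
Proof.
move=> n0; rewrite /lattice_point expk_frac.
have -> : expk z (\row_j (i%:R * (g 0 j)%:~R / n%:R)) =
    expi2pi (i%:R * ((int_dot z g)%:~R / n%:R : R)).
  rewrite /expk; congr expi2pi; rewrite /freq_dot /int_dot rmorph_sum mulr_suml mulr_sumr.
  by apply: eq_bigr => j _; rewrite mxE rmorphM/=; ring.
elim: i => [|i IH]; first by rewrite mul0r expi2pi0.
by rewrite -natr1 mulrDl mul1r expi2piD IH exprSr.
Qed.

Lemma sum_expk_lattice n z g : (0 < n)%N ->
  \sum_(i < n) expk z (lattice_point n g i) = n%:R * (n%:Z %| int_dot z g)%Z%:R :> R[i].
Proof.
move=> n0; under eq_bigr do rewrite expk_lattice_point//.
have n0' : n%:R != 0 :> R by rewrite pnatr_eq0 -lt0n.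
set w := expi2pi _.
have [/dvdzP[q zq]|nd] := boolP (n%:Z %| int_dot z g)%Z.
  have -> : w = 1.
    by rewrite /w zq intrM mulfK// expi2pi_int.
  by under eq_bigr do rewrite expr1n; rewrite sumr_const card_ord mulr1.
have w1 : w - 1 != 0.
  rewrite subr_eq0; apply: contra nd => /eqP/expi2pi_eq1[q] /(canRL (mulfVK n0')).
  move=> e; apply/dvdzP; exists q; apply: (@intr_inj R).
  by rewrite intrM -e.
apply/eqP; rewrite mulr0 -(mulrI_eq0 _ (mulfI w1)) -subrX1 subr_eq0; apply/eqP.
(* Index [i = n] gives a lattice point congruent to an integer vector, whence [w ^ n = 1] and the
   geometric sum vanishes. *)
have := expk_lattice_point z g n n0; rewrite -/w => <-.
rewrite /lattice_point expk_frac.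
have -> : \row_j (n%:R * (g 0 j)%:~R / n%:R) = map_mx intr g :> 'rV[R]_d.
  by apply/rowP => j; rewrite !mxE mulrAC mulfV// mul1r.
by rewrite expk_int.
Qed.

Variables (A : {fset 'rV[int]_d}) (lat : seq (nat * 'rV[int]_d)).
Hypotheses (lat0 : forall l, l \in lat -> (0 < l.1)%N)
  (xi1 : forall k, k \in A -> (1 <= xi A lat k)%N).

Definition alias_count k m : nat :=
  (\sum_(l <- lat) (aliasing_free A l.1 l.2 k && (l.1%:Z %| int_dot (m - k)%R l.2)%Z))%N.

(** The factor with which the coefficient at [m] enters the computed coefficient at [k], apart from
    the phase due to the shift. *)
Definition alias_weight k m : R := (alias_count k m)%:R / (xi A lat k)%:R.

Lemma alias_count_le_xi k m : (alias_count k m <= xi A lat k)%N.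
Proof. by apply: leq_sum => l _; case: aliasing_free => //=; exact: leq_b1. Qed.

Lemma alias_weight_diag k : k \in A -> alias_weight k k = 1.
Proof.
move=> kA; rewrite /alias_weight /alias_count.
rewrite (_ : (\sum_(l <- lat) _)%N = xi A lat k) ?mulfV ?pnatr_eq0 -?lt0n ?xi1//.
apply: eq_bigr => l _; rewrite subrr /int_dot big1 ?dvdz0 ?andbT// => j _.
by rewrite mxE mul0r.
Qed.

Lemma alias_weight_set k m : k \in A -> m \in A -> m != k -> alias_weight k m = 0.
Proof.
move=> kA mA mk; rewrite /alias_weight /alias_count big1 ?mul0r// => l _.
case: (boolP (aliasing_free _ _ _ _)) => //= /hasPn/(_ m).
rewrite !inE mk mA => /(_ isT); rewrite eqz_mod_dvd int_dotB => /negbTE ->.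
by [].
Qed.

(* Two frequencies aliasing with the same [m] alias with each other, so at most
   one frequency that is aliasing-free for a given lattice aliases with [m]. *)
Lemma sum_alias_count m : (\sum_(k <- A) alias_count k m <= size lat)%N.
Proof.
rewrite exchange_big/= -sum1_size; apply: leq_sum => l _.
have uA := fset_uniq A.
have [/hasP[k kA /andP[fk dk]]|/hasPn H] := boolP (has (fun k => aliasing_free A l.1 l.2 k &&
    (l.1%:Z %| int_dot (m - k)%R l.2)%Z) A); last first.
  by rewrite big1_seq// => k /andP[_ kA]; rewrite (negbTE (H k kA)).
rewrite (big_rem k)//= fk dk big1_seq// => k' /andP[_].
rewrite mem_rem_uniq// inE => /andP[kk' k'A]; move: fk => /hasPn/(_ k').
rewrite !inE kk' k'A => /(_ isT) nk.
case: (boolP (_ %| int_dot (m - k') _)%Z) => [dk'|]; last by rewrite andbF.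
move: nk; rewrite eqz_mod_dvd -int_dotB.
have -> : k' - k = (m - k) - (m - k') by rewrite opprB [RHS]addrC addrA subrK.
by rewrite int_dotB rpredB.
Qed.

(** The weights lie in [[0,1]], so their squares are at most the weights, which [xi >= 1] bounds by
    the counts. *)
Lemma sum_alias_weight m : \sum_(k <- A) alias_weight k m ^+ 2 <= (size lat)%:R.
Proof.
apply: (@le_trans _ _ (\sum_(k <- A) (alias_count k m)%:R)); last first.
  by rewrite -natr_sum ler_nat sum_alias_count.
rewrite big_seq [leRHS]big_seq; apply: ler_sum => k kA.
have x0 : 0 < (xi A lat k)%:R :> R by rewrite ltr0n xi1.
have w0 : 0 <= alias_weight k m by rewrite divr_ge0.
have w1 : alias_weight k m <= 1.
  by rewrite ler_pdivrMr// mul1r ler_nat alias_count_le_xi.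
rewrite expr2; apply: (le_trans (ler_piMl w0 w1)).
by rewrite ler_pdivrMr// ler_peMr// ler1n xi1.
Qed.

(** Fractional parts are invisible to the exponentials, so the shift factors out as [expk (m - k) D]
    and a character sum over the lattice remains. *)
Lemma mult_coef_trig s a k (D : 'rV[R]_d) :
  mult_coef A lat (trig s a) D k
    = \sum_(m <- s) a m * (alias_weight k m)%:C%C * expk (m - k) D.
Proof.
rewrite /mult_coef.
have step l : l \in lat ->
    (aliasing_free A l.1 l.2 k)%:R / l.1%:R *
    \sum_(i < l.1) trig s a (shifted_point l.1 l.2 i D)
                   * expi2pi (- freq_dot k (shifted_point l.1 l.2 i D))
  = \sum_(m <- s) a m * expk (m - k) D *
      (aliasing_free A l.1 l.2 k && (l.1%:Z %| int_dot (m - k)%R l.2)%Z)%:R.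
  move=> /lat0 n0; have n0' : l.1%:R != 0 :> R[i] by rewrite pnatr_eq0 -lt0n.
  have -> : \sum_(i < l.1) trig s a (shifted_point l.1 l.2 i D)
                   * expi2pi (- freq_dot k (shifted_point l.1 l.2 i D))
      = \sum_(m <- s) a m * expk (m - k) D * (l.1%:R * (l.1%:Z %| int_dot (m - k)%R l.2)%Z%:R).
    under [RHS]eq_bigr do rewrite -sum_expk_lattice// mulr_sumr.
    rewrite [RHS]exchange_big/=; apply: eq_bigr => i _.
    rewrite /trig mulr_suml; apply: eq_bigr => m _.
    rewrite -freq_dotNl -/(expk (- k) _) -mulrA -expkDl.
    rewrite /shifted_point expk_frac.
    have -> : \row_j (lattice_point l.1 l.2 i 0 j + D 0 j) = D + lattice_point l.1 l.2 i.
      by apply/rowP => j; rewrite !mxE addrC.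
    by rewrite expkDr mulrA.
  rewrite mulr_sumr; apply: eq_bigr => m _.
  case: aliasing_free; rewrite /= ?mul0r ?mulr0//.
  by rewrite mulrCA div1r mulKf.
rewrite (eq_big_seq _ step) exchange_big/= mulr_sumr; apply: eq_bigr => m _.
have -> : (alias_weight k m)%:C%C = (xi A lat k)%:R^-1 * \sum_(l <- lat)
    (aliasing_free A l.1 l.2 k && (l.1%:Z %| int_dot (m - k)%R l.2)%Z)%:R.
  by rewrite /alias_weight /alias_count rmorphM fmorphV !rmorph_nat natr_sum mulrC.
by rewrite -mulr_sumr mulrCA mulrAC.
Qed.

End LatticeRule.

(** * The mean square error *)

Section Integration.
Context {R : realType} {dT : measure_display} {T : measurableType dT}.
Variable P : probability T R.

(** Every simple function below [f] is below [g]. The comparison thus applies directly to the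
    squared error of a general [f] as a function of the shift. *)
Lemma ge0_le_integralT (f g : T -> \bar R) :
  (forall t, 0 <= f t)%E -> (forall t, f t <= g t)%E ->
  (\int[P]_t f t <= \int[P]_t g t)%E.
Proof.
move=> f0 fg; have g0 t : (0 <= g t)%E by exact: le_trans (f0 t) (fg t).
rewrite !ge0_integralTE//; apply: le_ereal_sup => _ [h /= hf <-].
by exists h => //= t; exact: le_trans (hf t) (fg t).
Qed.

Lemma integral_le_affine (f : T -> \bar R) (g : T -> R) (a b : R) :
  measurable_fun setT g -> (forall t, 0 <= g t) -> 0 <= a -> 0 <= b ->
  (forall t, 0 <= f t)%E -> (forall t, f t <= (a * g t + b)%:E)%E ->
  (\int[P]_t f t <= a%:E * \int[P]_t (g t)%:E + b%:E)%E.
Proof.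
move=> mg g0 a0 b0 f0 fg; apply: (le_trans (ge0_le_integralT f0 fg)).
have mgE : measurable_fun setT (fun t => (g t)%:E) by exact/measurable_EFinP.
under eq_integral do rewrite EFinD EFinM.
rewrite ge0_integralD//=.
- rewrite ge0_integralZl_EFin//=; last by move=> t _; rewrite lee_fin.
  by rewrite integral_cst//= probability_setT mule1.
- by move=> t _; rewrite -EFinM lee_fin mulr_ge0.
- by apply/measurable_EFinP; apply: measurable_funM.
Qed.

End Integration.

Section CubeL2.
Context {R : realType} {d : nat}.

Lemma cube_L2norm_sqr (h : 'rV[R]_d -> R[i]) :
  (cube_L2norm h ^+ 2 = \int[cube_measure d]_t (normc (h (cube_point t)) ^+ 2)%:E)%E.
Proof.
rewrite /cube_L2norm unlock.
have -> : (\int[cube_measure d]_t (`|(normc (h (cube_point t)))%:E| `^ 2))%E =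
   (\int[cube_measure d]_t (normc (h (cube_point t)) ^+ 2)%:E)%E.
  apply: eq_integral => t _; rewrite abse_EFin ger0_norm ?normc_ge0// poweR_EFin.
  by rewrite powR_mulrn ?normc_ge0.
rewrite poweR12_sqrt ?sqr_sqrte//; apply: integral_ge0 => t _; rewrite lee_fin sqr_ge0//.
Qed.

End CubeL2.

Section TrigonometricError.
Context {R : realType} {d : nat}.
Local Notation MR := (measurableTypeR R).
Local Notation mu := (@cube_measure R d).
Local Notation cp := (@cube_point R d).
Local Notation Re := complex.Re.
Implicit Types (k m z g : 'rV[int]_d) (a : 'rV[int]_d -> R[i]) (D : 'rV[R]_d).
Variables (A : {fset 'rV[int]_d}) (lat : seq (nat * 'rV[int]_d)).
Hypotheses (lat0 : forall l, l \in lat -> (0 < l.1)%N)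
  (xi1 : forall k, k \in A -> (1 <= xi A lat k)%N).
Variables (t : seq 'rV[int]_d) (a : 'rV[int]_d -> R[i]).
Hypotheses (ut : uniq t) (tA : forall k, k \in t -> k \notin A).
Let s := enum_fset A ++ t.

Lemma uniq_freqs : uniq s.
Proof.
by rewrite cat_uniq fset_uniq ut andbT/=; apply/hasPn => k /tA.
Qed.

(** Error of the computed coefficient at [k], up to a phase, as a trigonometric polynomial in the
    shift; this is what makes a second use of Parseval possible. *)
Definition alias_part k : 'rV[R]_d -> R[i] :=
  trig t (fun m => a m * (alias_weight A lat k m : R)%:C%C).

Definition error_coef D m : R[i] :=
  if m \in A then - (alias_part m D * expk (- m) D) else a m.

Lemma mult_approx_error D x :
  trig s a x - mult_approx A lat (trig s a) D x = trig s (error_coef D) x.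
Proof.
have coefE k : k \in A -> mult_coef A lat (trig s a) D k = a k + alias_part k D * expk (- k) D.
  move=> kA; rewrite (mult_coef_trig A lat0) /s big_cat/=; congr (_ + _).
    rewrite (big_rem k)//= alias_weight_diag// subrr expk0 !mulr1 big1_seq ?addr0// => m /andP[_].
    rewrite mem_rem_uniq ?fset_uniq// inE => /andP[mk mA].
    by rewrite alias_weight_set// mulr0 mul0r.
  rewrite /alias_part /trig mulr_suml; apply: eq_bigr => m _.
  by rewrite expkDl mulrA.
rewrite /mult_approx {1}/trig /s big_cat/= [in RHS]/trig big_cat/= addrAC; congr (_ + _).
  rewrite -sumrB big_seq [RHS]big_seq; apply: eq_bigr => k kA.
  rewrite coefE// /error_coef kA /expk -/(expk _ _) -/(expk k x).
  by rewrite mulrDl opprD addrA subrr sub0r mulNr.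
rewrite big_seq [RHS]big_seq; apply: eq_bigr => m /tA mA.
by rewrite /error_coef (negbTE mA).
Qed.

Definition shift_error D : R :=
  \sum_(k <- A) normc (alias_part k D) ^+ 2 + \sum_(m <- t) normc (a m) ^+ 2.

Lemma shift_error_ge0 D : 0 <= shift_error D.
Proof. by rewrite addr_ge0// sumr_ge0// => k _; rewrite sqr_ge0. Qed.

Lemma shift_errorE D :
  (\int[mu]_u (normc (trig s a (cp u) - mult_approx A lat (trig s a) D (cp u)) ^+ 2)%:E
    = (shift_error D)%:E)%E.
Proof.
under eq_integral do rewrite mult_approx_error.
rewrite parseval_trig ?uniq_freqs// /s big_cat/=; congr (_ + _)%:E.
  rewrite big_seq [RHS]big_seq; apply: eq_bigr => k kA.
  by rewrite /error_coef kA normcN normcM normc_expk mulr1.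
rewrite big_seq [RHS]big_seq; apply: eq_bigr => m /tA mA.
by rewrite /error_coef (negbTE mA).
Qed.

Lemma measurable_alias_part k :
  measurable_fun setT (fun D : d.-tuple MR => normc (alias_part k (cp D)) ^+ 2).
Proof.
have [[mr _] [mi _]] := cbounded_measurable_trig (R := R) t
  (fun m => a m * (alias_weight A lat k m : R)%:C%C).
under eq_fun do rewrite sqr_normcE.
by apply: measurable_funD; exact: measurable_funX.
Qed.

Lemma measurable_shift_error : measurable_fun setT (fun D : d.-tuple MR => shift_error (cp D)).
Proof.
apply: measurable_funD => //; apply: measurable_sum => k; exact: measurable_alias_part.
Qed.

(** Aliasing contributes the factor [size lat], truncation to [A] contributes the 1. *)
Lemma integral_shift_error_le :
  (\int[mu]_D (shift_error (cp D))%:E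
    <= ((size lat + 1)%:R * \sum_(m <- t) normc (a m) ^+ 2)%:E)%E.
Proof.
have ms k : measurable_fun setT (fun D : d.-tuple MR => (normc (alias_part k (cp D)) ^+ 2)%:E).
  by apply/measurable_EFinP; exact: measurable_alias_part.
under eq_integral do rewrite /shift_error EFinD.
rewrite ge0_integralD//=; last 3 first.
- by move=> D _; rewrite lee_fin sumr_ge0// => k _; rewrite sqr_ge0.
- by apply/measurable_EFinP; apply: measurable_sum => k; exact: measurable_alias_part.
- by move=> D _; rewrite lee_fin sumr_ge0// => k _; rewrite sqr_ge0.
rewrite integral_cst//= probability_setT mule1.
under eq_integral do rewrite -sumEFin.
rewrite ge0_integral_sum//; last by move=> k D _; rewrite lee_fin sqr_ge0.
rewrite (eq_bigr (fun k => (\sum_(m <- t) normc (a m * (alias_weight A lat k m : R)%:C%C) ^+ 2)%:E));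
  last by move=> k _; exact: parseval_trig.
rewrite sumEFin -EFinD lee_fin natrD mulrDl mul1r lerD2r.
rewrite exchange_big/= mulr_sumr; apply: ler_sum => m _.
under eq_bigr do rewrite normcM exprMn normc_real real_normK ?num_real//.
rewrite -mulr_sumr mulrC ler_wpM2r ?sqr_ge0//.
exact: sum_alias_weight.
Qed.

End TrigonometricError.

Section KorobovError.
Context {R : realType} {d : nat}.
Local Notation MR := (measurableTypeR R).
Local Notation mu := (@cube_measure R d).
Local Notation cp := (@cube_point R d).
Implicit Types (f p : 'rV[R]_d -> R[i]) (x D : 'rV[R]_d).
Variables (A : {fset 'rV[int]_d}) (lat : seq (nat * 'rV[int]_d)).

Lemma normc_nat n : normc (n%:R : R[i]) = n%:R.
Proof. by rewrite -(rmorph_nat (real_complex R)) normc_real normr_nat. Qed.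

Lemma normc_inv_nat_le1 n : normc ((n%:R)^-1 : R[i]) <= 1.
Proof.
rewrite normcV normc_nat; case: n => [|n]; first by rewrite invr0.
by rewrite invf_le1// ler1n.
Qed.

(** A crude constant is enough: it only has to be independent of [e]. *)
Lemma mult_coef_sub_le f p e D k : (forall x, normc (f x - p x) <= e) ->
  normc (mult_coef A lat f D k - mult_coef A lat p D k) <= (size lat)%:R * e.
Proof.
move=> fp; have e0 : 0 <= e by apply: le_trans (fp 0); exact: normc_ge0.
rewrite /mult_coef -mulrBr normcM -sumrB.
apply: le_trans (ler_piMl (normc_ge0 _) (normc_inv_nat_le1 _)) _.
apply: (le_trans (normc_sum_le _ _ _)).
rewrite -sum1_size natr_sum mulr_suml; apply: ler_sum => l _.
rewrite mul1r -mulrBr -sumrB normcM normcM.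
have -> : normc ((aliasing_free A l.1 l.2 k)%:R : R[i]) * normc ((l.1%:R)^-1 : R[i])
    = (aliasing_free A l.1 l.2 k)%:R / l.1%:R.
  by rewrite normcV !normc_nat.
have sumle : normc (\sum_(i < l.1) (f (shifted_point l.1 l.2 i D) * expi2pi (- freq_dot k (shifted_point l.1 l.2 i D))
    - p (shifted_point l.1 l.2 i D) * expi2pi (- freq_dot k (shifted_point l.1 l.2 i D)))) <= l.1%:R * e.
  apply: (le_trans (normc_sum_le _ _ _)).
  apply: (@le_trans _ _ (\sum_(i < l.1) e)); last by rewrite sumr_const card_ord mulr_natl.
  by apply: ler_sum => i _; rewrite -mulrBl normcM normc_expi2pi mulr1.
case: l.1 sumle => [|n] sumle.
  by rewrite invr0 mulr0 mul0r.
apply: (@le_trans _ _ (n.+1%:R^-1 * (n.+1%:R * e))); last by rewrite mulKf.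
rewrite ler_pM ?normc_ge0// ?mulr_ge0 ?invr_ge0//.
by rewrite ler_piMl ?invr_ge0// lern1 leq_b1.
Qed.

Lemma mult_approx_sub_le f p e D x : (forall x, normc (f x - p x) <= e) ->
  normc (mult_approx A lat f D x - mult_approx A lat p D x)
    <= #|` A|%:R * (size lat)%:R * e.
Proof.
move=> fp; rewrite /mult_approx -sumrB; apply: (le_trans (normc_sum_le _ _ _)).
rewrite -mulrA card_fset_sum1 natr_sum mulr_suml; apply: ler_sum => k _.
by rewrite mul1r -mulrBl normcM normc_expi2pi mulr1 mult_coef_sub_le.
Qed.

(** Young's inequality [2 v C <= eta v^2 + C^2 / eta], which keeps the factor of [v^2] arbitrarily
    close to 1. *)
Lemma sqr_le_affine (u v C eta : R) : 0 <= u -> 0 <= v -> 0 < eta -> u <= v + C ->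
  u ^+ 2 <= (1 + eta) * v ^+ 2 + (1 + eta^-1) * C ^+ 2.
Proof.
move=> u0 v0 eta0 uvC; have eta0' : 0 < eta^-1 by rewrite invr_gt0.
have : 0 <= (v + C) by apply: le_trans uvC.
have /le_trans -> // : u ^+ 2 <= (v + C) ^+ 2.
  by rewrite lerXn2r ?nnegrE// (le_trans u0).
have e1 : eta * eta^-1 = 1 by rewrite mulfV// gt_eqF.
have : 0 <= eta^-1 * (eta * v - C) ^+ 2 by rewrite mulr_ge0 ?sqr_ge0// ltW.
have -> : eta^-1 * (eta * v - C) ^+ 2 =
   (eta * eta^-1) * (eta * v ^+ 2) - (eta * eta^-1) * (2 * v * C) + eta^-1 * C ^+ 2 by ring.
by rewrite e1; lra.
Qed.

Lemma frac_mul_le_half (K del : R) : 0 <= K -> 0 < del ->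
  del / (2 * (K + 1)) * K <= del / 2.
Proof.
move=> K0 del0; rewrite mulrAC ler_pdivrMr ?mulr_gt0 ?ltr_wpDl//.
have -> : del / 2 * (2 * (K + 1)) = del * K + del by field.
by lra.
Qed.

Variables (alpha : R) (gamma : {fset nat} -> R) (M : R).
Hypotheses (alpha2 : 2^-1 < alpha) (gamma0 : forall u, 0 <= gamma u) (M1 : 1 <= M).
Hypotheses (AE : A = korobov_ball alpha gamma M)
  (lat0 : forall l, l \in lat -> (0 < l.1)%N)
  (xi1 : forall k, k \in A -> (1 <= xi A lat k)%N).

Lemma korobov_mean_square_error f : in_korobov alpha gamma f ->
  (korobov_norm alpha gamma f <= 1)%E ->
  (\int[mu]_D (cube_L2norm (fun x => f x - mult_approx A lat f (cp D) x)%R ^+ 2)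
    <= ((size lat + 1)%:R / M ^+ 2)%:E)%E.
Proof.
move=> fK f1; set K := (size lat + 1)%:R / M ^+ 2.
have K0 : 0 <= K by rewrite divr_ge0// sqr_ge0.
apply/lee_addgt0Pr => del del0.
pose C := 1 + #|` A|%:R * (size lat)%:R : R.
have C0 : 0 < C by rewrite ltr_wpDr// mulr_ge0.
(* [eta] is fixed first, so that [eta * K <= del / 2]; then [e] absorbs the large factor
   [1 + 1/eta]. The bound [e <= 1] gives [e^2 <= e]. *)
pose eta := del / (2 * (K + 1)).
have eta0 : 0 < eta by rewrite divr_gt0// mulr_gt0// ltr_wpDl.
have W0 : 0 < (1 + eta^-1) * C ^+ 2 by rewrite mulr_gt0 ?exprn_gt0// addr_gt0// invr_gt0.
pose e := Num.min 1 (del / 2 / ((1 + eta^-1) * C ^+ 2)).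
have e0 : 0 < e by rewrite lt_min ltr01/= !divr_gt0.
have e1 : e <= 1 by rewrite ge_min lexx.
have [s [us As fs]] := korobov_uniform_approx alpha2 gamma0 fK f1 A e0.
pose t := [seq k <- s | k \notin A].
have ut : uniq t by rewrite filter_uniq.
have tA k : k \in t -> k \notin A by rewrite mem_filter => /andP[].
pose a := fourier_coef f.
pose p := trig (enum_fset A ++ t) a.
have pE : p = trig s a.
  apply/funext => x; apply: perm_big; apply: uniq_perm => //; first exact: uniq_freqs.
  have E k : (k \in enum_fset A) = (k \in A) by [].
  by move=> k; rewrite mem_cat mem_filter E; case: (boolP (k \in A)) => [/As|_].
have fp x : normc (f x - p x) <= e by rewrite pE.
pose g D := shift_error A lat t a D.
have inner (D : d.-tuple MR) :
    (cube_L2norm (fun x => f x - mult_approx A lat f (cp D) x)%R ^+ 2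
      <= ((1 + eta) * g (cp D) + (1 + eta^-1) * (C * e) ^+ 2)%:E)%E.
  rewrite cube_L2norm_sqr EFinD EFinM.
  rewrite /g -(shift_errorE lat0 xi1 a ut tA).
  apply: integral_le_affine.
  - under eq_fun do rewrite (mult_approx_error lat0 xi1 a tA) sqr_normcE.
    have [[mr _] [mi _]] := cbounded_measurable_trig (R := R) (enum_fset A ++ t) (error_coef A lat t a (cp D)).
    by apply: measurable_funD; exact: measurable_funX.
  - by move=> u; exact: sqr_ge0.
  - by rewrite addr_ge0// ltW.
  - by rewrite mulr_ge0 ?sqr_ge0// addr_ge0// invr_ge0 ltW.
  - by move=> u; rewrite lee_fin sqr_ge0.
  move=> u; rewrite lee_fin; apply: sqr_le_affine => //; rewrite ?normc_ge0//.
  set F := f (cp u); set Af := mult_approx A lat f _ _.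
  rewrite -/p; set p0 := p (cp u); set Ap := mult_approx A lat p _ _.
  have -> : F - Af = (p0 - Ap) + ((F - p0) - (Af - Ap)) by ring.
  apply: (le_trans (le_normcD _ _)); rewrite lerD2l.
  apply: (le_trans (le_normcD _ _)); rewrite normcN /C mulrDl mul1r lerD//.
    exact: fp.
  exact: mult_approx_sub_le.
apply: (@le_trans _ _ ((1 + eta)%:E * \int[mu]_D (g (cp D))%:E + ((1 + eta^-1) * (C * e) ^+ 2)%:E)%E).
  apply: integral_le_affine => //.
  - exact: measurable_shift_error.
  - by move=> D; exact: shift_error_ge0.
  - by rewrite addr_ge0// ltW.
  - by rewrite mulr_ge0 ?sqr_ge0// addr_ge0// invr_ge0 ltW.
  - by move=> D; rewrite expe2 mule_ge0//; apply: Lnorm_ge0.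
have tail : (size lat + 1)%:R * \sum_(m <- t) normc (a m) ^+ 2 <= K.
  rewrite /K ler_wpM2l//; apply: (korobov_sum_tail alpha2 gamma0 fK f1) => //.
  by move=> k /tA; rewrite AE.
have gK : (\int[mu]_D (g (cp D))%:E <= K%:E)%E.
  apply: le_trans (integral_shift_error_le xi1 a ut) _.
  by rewrite lee_fin.
rewrite -EFinD; apply: (@le_trans _ _ ((1 + eta)%:E * K%:E + ((1 + eta^-1) * (C * e) ^+ 2)%:E)%E).
  by rewrite leeD2r// lee_wpmul2l// lee_fin addr_ge0// ltW.
rewrite -EFinM -EFinD lee_fin mulrDl mul1r -addrA lerD2l (splitr del) lerD//.
  exact: frac_mul_le_half.
apply: (@le_trans _ _ ((1 + eta^-1) * C ^+ 2 * e)).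
  by rewrite exprMn mulrA ler_pM2l// expr2 ler_piMl// ltW.
by rewrite -ler_pdivlMl// mulrC ge_min lexx orbT.
Qed.

Lemma err_rand_le :
  (err_rand alpha gamma A lat <= (Num.sqrt (size lat + 1)%:R / M)%:E)%E.
Proof.
have M0 : 0 < M by exact: lt_le_trans M1.
apply: ge_ereal_sup => _ [f [fK f1] <-].
have -> : (Num.sqrt (size lat + 1)%:R / M)%:E = sqrte ((size lat + 1)%:R / M ^+ 2)%:E.
  by rewrite /= sqrtrM// sqrtrV ?sqr_ge0// sqrtr_sqr gtr0_norm.
rewrite lee_sqrt; last by rewrite lee_fin divr_ge0// sqr_ge0.
exact: korobov_mean_square_error.
Qed.

End KorobovError.

(** * Coverage and the error bound combined *)

Theorem theorem4p6 (R : realType) (alpha : R) (d : nat) (gamma : {fset nat} -> R)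
    (M c delta : R)
    (A := korobov_ball alpha gamma M : {fset 'rV[int]_d})
    (dO : measure_display) (Omega : measurableType dO) (P : probability Omega R)
    (G : nat -> Omega -> 'rV[int]_d) :
  2^-1 < alpha -> (1 <= d)%N ->
  (forall u, 0 <= gamma u) -> gamma fset0 = 1 ->
  1 <= M -> 1 < c -> 0 < delta < 1 ->
  (2 <= #|` A|)%N ->
  Num.max ((freq_width A)%:~R)
    (4 * (lc_Lmax A c delta)%:R * ln (lc_Lmax A c delta)%:R) <= lc_eta A c ->
  lc_draws A c delta P G ->
  let good := [set w | exists lat : seq (nat * 'rV[int]_d),
    [/\ lc_output A c delta (fun i => G i w) lat,
        forall k, k \in A -> (1 <= xi A lat k)%N
      & (err_rand alpha gamma A lat
           <= (Num.sqrt (size lat + 1)%:R / M)%:E)%E]] in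
  measurable good /\ ((1 - delta)%:E <= P good)%E.
Proof.
move=> alpha2 _ gamma0 _ M1 c1 /andP[delta0 _] A2 _ [mG drawsG] good.
pose Q (lat : seq (nat * 'rV[int]_d)) := (forall k, k \in A -> (1 <= xi A lat k)%N) /\
  (err_rand alpha gamma A lat <= (Num.sqrt (size lat + 1)%:R / M)%:E)%E.
(* Success depends only on the state in which the loop stops, which makes [good] a countable union
   of events on states. *)
have goodE : good = \bigcup_i [set w |
    [set st : @lc_state d | ~~ lc_running A c delta st /\ Q st.2]
      (lc_run A c delta (fun i => G i w) i)].
  apply/seteqP; split => w.
    by move=> [lat [[i nrun ->] xi1 err]]; exists i.
  by move=> [i _ [nrun [xi1 err]]]; exists (lc_run A c delta (fun i => G i w) i).2; split => //; exists i.
have mgood : measurable good.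
  by rewrite goodE; apply: bigcupT_measurable => i; exact: measurable_lc_run.
split=> //; have bound := lc_Lmax_bound c1 delta0 (leq_trans (leqnSn 1) A2).
apply: (le_trans (lc_covers mG c1 drawsG bound)).
apply: le_measure; rewrite ?inE//.
  by apply: bigcupT_measurable => i; exact: measurable_covered.
rewrite goodE => w [i _ /= cov]; exists i => //=.
set st := lc_run _ _ _ _ _ in cov *.
have xi1 k : k \in A -> (1 <= xi A st.2 k)%N.
  by move=> kA; have := fsubsetP cov k kA; rewrite mem_lc_run => /andP[].
(* Once [A] is covered, [B_d] has at least [|A|] elements and the loop has stopped. *)
split; first by rewrite /lc_running negb_and -leqNgt fsubset_leq_card.
split=> //; apply: err_rand_le => // l; exact: lc_run_moduli.
Qed.
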